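(* Let $m>n$ and let $s>1$, $t\ge 0$ be integers with $s+t<\log n$. If property $\mathrm{PHP}(s-1,s+t)$ holds, then property $\mathrm{PHP}(s,t)$ holds.
   Context: $n$ is a power of 2; for a hole $a\in[n]$, $a_1\dots a_{\log n}$ is its binary representation; $\omega^1=\omega$, $\omega^0=\neg\omega$. $\mathrm{BinPHP}^m_n$ has variables $\omega_{i,\ell}$ ($i\in[m]$ pigeons, $\ell\in[\log n]$) and, for all $i\neq i'\in[m]$, $a\in[n]$, the clause $\bigvee_{\ell}\omega_{i,\ell}^{1-a_\ell}\vee\bigvee_\ell\omega_{i',\ell}^{1-a_\ell}$. A $t$-bit restriction assigns exactly $t$ of the variables $\omega_{i,1},\dots,\omega_{i,\log n}$ for each pigeon $i$; $F\!\upharpoonright_\rho$ is $F$ simplified under $\rho$. Let $\xi(1)=1$ and $\xi(s)=\xi(s-1)+1+s$, and $u=u(n,t)=\log n-t$. Property $\mathrm{PHP}(s,t)$ (for $s,t$ with $s\ge1$): for every $t$-bit restriction $\rho$ to $\mathrm{BinPHP}^m_n$ there is no $\mathrm{Res}(s)$ refutation of $\mathrm{BinPHP}^m_n\!\upharpoonright_\rho$ of size smaller than $e^{\frac{n}{4^{\xi(s)+1}\, s!\, 2^t\, u^{\xi(s)}}}$ (with $u=\log n-t$ for that $t$). $\mathrm{Res}(s)$ is the refutation system whose lines are $s$-DNFs, with rules: $\wedge$-introduction (from $\mathcal{D}_1\vee\bigwedge_{J_1}l_j$ and $\mathcal{D}_2\vee\bigwedge_{J_2}l_j$ derive $\mathcal{D}_1\vee\mathcal{D}_2\vee\bigwedge_{J_1\cup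 J_2}l_j$ if $|J_1\cup J_2|\le s$), cut (from $\mathcal{D}_1\vee\bigvee_{J}l_j$ and $\mathcal{D}_2\vee\bigwedge_J\neg l_j$ derive $\mathcal{D}_1\vee\mathcal{D}_2$), weakening (from $\mathcal{D}$ derive $\mathcal{D}\vee\bigwedge_J l_j$, $|J|\le s$; from $\mathcal{D}\vee\bigwedge_{J_1\cup J_2}l_j$ derive $\mathcal{D}\vee\bigwedge_{J_1}l_j$). Size = number of rule applications. *)

(* Defs.v *)
From HB Require Import structures.
From mathcomp Require Export all_boot all_order all_algebra.
From mathcomp Require Export reals sequences exp.

Set Implicit Arguments.
Unset Strict Implicit.
Unset Printing Implicit Defensive.

(* The literal (v, true) is v and (v, false) is its negation. *)
Definition literal (V : finType) : finType := (V * bool)%type.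

Definition neg_lit (V : finType) (l : literal V) : literal V := (l.1, ~~ l.2).

(* A term is the conjunction of a set of literals; a DNF is the disjunction of
   a set of terms, so set0 : dnf V is the contradiction. *)
Definition term (V : finType) : finType := {set literal V}.
Definition dnf (V : finType) : finType := {set term V}.

Definition clause (V : finType) : finType := {set literal V}.
Definition cnf (V : finType) : finType := {set clause V}.

(* The disjunction of the literals in J, each taken as a term of width 1. *)
Definition dnf_of_clause (V : finType) (J : clause V) : dnf V :=
  [set [set l] | l in J].

Definition is_sdnf (V : finType) (s : nat) (D : dnf V) : bool :=
  [forall T in D, #|T| <= s].

(* res_step s P D : D follows from DNFs in P by one application of a rule. *)
Inductive res_step (V : finType) (s : nat) (P : seq (dnf V)) : dnf V -> Prop :=
| res_and (D1 D2 : dnf V) (J1 J2 : term V) :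
    D1 :|: [set J1] \in P -> D2 :|: [set J2] \in P -> #|J1 :|: J2| <= s ->
    res_step s P (D1 :|: D2 :|: [set J1 :|: J2])
| res_cut (D1 D2 : dnf V) (J : {set literal V}) :
    D1 :|: dnf_of_clause J \in P ->
    D2 :|: [set [set neg_lit l | l in J]] \in P ->
    res_step s P (D1 :|: D2)
| res_weak (D : dnf V) (J : term V) :
    D \in P -> #|J| <= s ->
    res_step s P (D :|: [set J])
| res_weak_term (D : dnf V) (J1 J2 : term V) :
    D :|: [set J1 :|: J2] \in P ->
    res_step s P (D :|: [set J1]).

Definition axiom_lines (V : finType) (F : cnf V) : seq (dnf V) :=
  [seq dnf_of_clause C | C <- enum F].

(* The sequence prf lists only the lines obtained by a rule, in order; the
   clauses of F are available as premises without being listed. Hence size prf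
   is the number of rule applications. *)
Definition res_derivation (V : finType) (s : nat) (F : cnf V)
    (prf : seq (dnf V)) : Prop :=
  forall i, i < size prf ->
    is_sdnf s (nth set0 prf i) /\
    res_step s (axiom_lines F ++ take i prf) (nth set0 prf i).

Definition res_refutation (V : finType) (s : nat) (F : cnf V)
    (prf : seq (dnf V)) : Prop :=
  res_derivation s F prf /\ set0 \in axiom_lines F ++ prf.

Definition restriction (V : finType) := V -> option bool.

(* Satisfied clauses are deleted, falsified literals are removed from the
   remaining ones. *)
Definition restrict_cnf (V : finType) (rho : restriction V) (F : cnf V) :
    cnf V :=
  [set [set l in C | rho l.1 != Some (~~ l.2)]
     | C : clause V in F & [forall l in C, rho l.1 != Some l.2]].

(* Exact base-2 logarithm when n is a power of 2. *)
Definition lg (n : nat) : nat := trunc_log 2 n.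

Definition php_var (m n : nat) : finType := ('I_m * 'I_(lg n))%type.

(* Holes are 0, ..., n - 1. The bit with (0-based) index j is counted from the
   most significant one. *)
Definition hole_bit (n : nat) (a : 'I_n) (j : 'I_(lg n)) : bool :=
  odd (a %/ 2 ^ (lg n - j.+1)).

Definition not_in_hole (m n : nat) (i : 'I_m) (a : 'I_n) :
    clause (php_var m n) :=
  [set (((i, j) : php_var m n), ~~ hole_bit a j) | j : 'I_(lg n)].

Definition BinPHP (m n : nat) : cnf (php_var m n) :=
  [set C | [exists i : 'I_m, exists i' : 'I_m, exists a : 'I_n,
     (i != i') && (C == not_in_hole i a :|: not_in_hole i' a)]].

Definition bit_restriction (m n t : nat) (rho : restriction (php_var m n)) :
    Prop :=
  forall i : 'I_m, #|[set j : 'I_(lg n) | rho (i, j) != None]| = t.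

(* Only the values at s >= 1 are meaningful. *)
Fixpoint xi (s : nat) : nat :=
  match s with
  | 0 => 0
  | 1 => 1
  | s'.+1 => xi s' + 1 + s
  end.

Definition size_bound (R : realType) (n s t : nat) : R :=
  let u := lg n - t in
  expR (n%:R / (4 ^ (xi s + 1) * s`! * 2 ^ t * u ^ xi s)%N%:R)%R.

Definition PHP (R : realType) (m n s t : nat) : Prop :=
  forall rho : restriction (php_var m n), bit_restriction t rho ->
  ~ exists prf : seq (dnf (php_var m n)),
      res_refutation s (restrict_cnf rho (BinPHP m n)) prf /\
      ((size prf)%:R < size_bound R n s t)%R.

(* Main.v *)
Require Import Defs.
From mathcomp Require Import zify ring lra.

(** Let [u = log n - t].  In a short [Res(s)] refutation of the restricted
    principle, call a line a bottleneck if it has at least [r] terms on pairwise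
    disjoint sets of pigeons.  A random choice of [s] further bits per pigeon
    satisfies such a term with probability at least [s / (2 u)^s], independently
    for disjoint sets of pigeons; by the method of conditional expectations one
    choice satisfies all bottlenecks.  In any other line, every term meets one
    of the few pigeons of a maximal disjoint family of terms, so after branching
    on the [(r - 1) s u] unset variables of these pigeons all terms have width
    at most [s - 1].  Replacing each line by the family of its branches gives a
    [Res(s - 1)] refutation that is longer by a factor exponential only in the
    number of branching variables. *)

Set Implicit Arguments.
Unset Strict Implicit.
Unset Printing Implicit Defensive.

(** Size counts lines, whereas splitting a line into branches and merging them back costs steps for
    each of its terms. The terms per line are therefore bounded through the number of lines: each
    rule creates at most one new term. Without excluded middle, a line is recovered from three
    branches per variable instead of two, the third one carrying both literals.

    The branching variables differ from line to line. An inference is simulated over the variables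
    of its premises and conclusion together, and those of the premises are then merged away; with
    [d] variables per line this costs about [4^(3 d)] steps.

    Let [X] be the exponent of the lower bound for width [s - 1]. A threshold [r] close to
    [X / (4 s^2 u)] gives [d <= X / 8], hence [4^(3 d) <= exp (3 X / 4)], and lets a bottleneck
    survive with probability at most [exp (- X / c)] for [c = 4 * 2^s * s * u^(s+1)]. Here [X / c]
    is exactly the exponent for width [s]. This explains the recursion of [xi]: [s] factors [u] come
    from fixing up to [s] literals, one more from the [u] variables branched on per pigeon. *)

(** * Derivations up to subsumption, with step counts *)

Section Derivability.
Variables (V : finType) (w : nat).
Implicit Types (P Q : seq (dnf V)) (D : dnf V) (J T : term V).

Definition extends P (q : seq (dnf V)) : Prop :=
  forall i, i < size q ->
    is_sdnf w (nth set0 q i) /\ res_step w (P ++ take i q) (nth set0 q i).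

Lemma extends_cat P q1 q2 :
  extends P q1 -> extends (P ++ q1) q2 -> extends P (q1 ++ q2).
Proof.
move=> e1 e2 i; rewrite size_cat nth_cat take_cat => hi.
case: ltnP => h; first exact: e1.
by rewrite catA; apply: e2; rewrite ltn_subLR.
Qed.

Lemma extends1 P D : is_sdnf w D -> res_step w P D -> extends P [:: D].
Proof. by move=> wD st [|//] _; rewrite /= cats0. Qed.

Lemma extends_sdnf P q :
  all (is_sdnf w) P -> extends P q -> all (is_sdnf w) (P ++ q).
Proof.
move=> gP e; rewrite all_cat gP /=; apply/(all_nthP set0) => i /e.
by case.
Qed.

(* A DNF containing the empty term is true and is never written down. *)
Definition subsumed P D : Prop :=
  set0 \in D \/ exists2 M, M \in P & M \subset D.

(** Only a line subsuming [D] has to be derived: adding terms then costs no step, and [D] itself may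
    contain terms wider than [w]. *)
Definition derivable P c D : Prop :=
  exists q, [/\ extends P q, size q <= c & subsumed (P ++ q) D].

Lemma sub_subsumed P Q D D' :
  {subset P <= Q} -> D \subset D' -> subsumed P D -> subsumed Q D'.
Proof.
move=> sPQ sD [h|[M MP MD]]; [left|right]; first exact: (subsetP sD).
by exists M; [exact: sPQ | exact: subset_trans MD sD].
Qed.

Lemma subsumed_catl P q D : subsumed P D -> subsumed (P ++ q) D.
Proof. by apply: sub_subsumed => // M MP; rewrite mem_cat MP. Qed.

Lemma subsumed_derivable P c D : subsumed P D -> derivable P c D.
Proof. by move=> h; exists [::]; split=> //; exact: subsumed_catl. Qed.

Lemma derivable_sub P c c' D D' :
  c <= c' -> D \subset D' -> derivable P c D -> derivable P c' D'.
Proof.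
move=> cc sD [q [e sq h]]; exists q; split=> //; first exact: leq_trans cc.
exact: sub_subsumed h.
Qed.

(** The continuation must work for every list of lines containing [P], so later arguments never name
    the lines that were actually derived. *)
Lemma derivable_bind P c c' D D' :
  all (is_sdnf w) P -> derivable P c D ->
  (forall P', all (is_sdnf w) P' -> {subset P <= P'} -> subsumed P' D ->
     derivable P' c' D') ->
  derivable P (c + c') D'.
Proof.
move=> gP [q [e sq h]] k.
have sP : {subset P <= P ++ q} by move=> M MP; rewrite mem_cat MP.
have [q' [e' sq' h']] := k _ (extends_sdnf gP e) sP h.
exists (q ++ q'); split; first exact: extends_cat.
- by rewrite size_cat leq_add.
- by rewrite catA.
Qed.

Lemma derivable_step P c (M D : dnf V) :
  0 < c -> is_sdnf w M -> res_step w P M -> M \subset D -> derivable P c D.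
Proof.
move=> c0 wM st sM; exists [:: M]; split=> //; first exact: extends1.
by right; exists M => //; rewrite mem_cat inE eqxx orbT.
Qed.

Lemma sdnfP (D : dnf V) : reflect {in D, forall T, #|T| <= w} (is_sdnf w D).
Proof. exact: forall_inP. Qed.

Lemma subsetU_notin (M D : dnf V) T :
  T \notin M -> M \subset D :|: [set T] -> M \subset D.
Proof.
move=> TM /subsetP sM; apply/subsetP => T' T'M.
have := sM _ T'M; rewrite !inE => /orP[//|/eqP TT].
by rewrite TT (negPf TM) in T'M.
Qed.

Lemma subD1U (M D : dnf V) T : M \subset D :|: [set T] -> M :\ T \subset D.
Proof.
move=> /subsetP sM; apply/subsetP => T'; rewrite !inE => /andP[ne /sM].
by rewrite !inE (negPf ne) orbF.
Qed.

Lemma D1U (M : dnf V) T : T \in M -> M :\ T :|: [set T] = M.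
Proof. by move=> TM; rewrite setUC setD1K. Qed.

Lemma set0_in_U1 D T : set0 \in D :|: [set T] -> set0 \in D \/ T = set0.
Proof. by rewrite !inE => /orP[->|/eqP ->]; [left|right]. Qed.

Lemma derivable_weak_term P D J1 J2 :
  all (is_sdnf w) P -> J1 \subset J2 -> subsumed P (D :|: [set J2]) ->
  derivable P 1 (D :|: [set J1]).
Proof.
move=> gP s12 [|[M MP sM]].
  move=> /set0_in_U1 [h|h]; apply: subsumed_derivable; left; rewrite !inE ?h //.
  by move: s12; rewrite h subset0 => /eqP ->; rewrite eqxx orbT.
have [J2M|J2M] := boolP (J2 \in M); last first.
  apply: subsumed_derivable; right; exists M => //.
  by apply: subset_trans (subsetUl _ _); exact: subsetU_notin sM.
have /sdnfP wM : is_sdnf w M by exact: (allP gP).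
apply: (@derivable_step _ _ (M :\ J2 :|: [set J1])) => //.
- apply/sdnfP => T; rewrite !inE => /orP[/andP[_ /wM]//|/eqP ->].
  exact: leq_trans (subset_leq_card s12) (wM _ J2M).
- apply: (@res_weak_term _ _ _ _ _ J2).
  by rewrite (setUidPr s12) D1U.
- by apply: setSU; exact: subD1U.
Qed.

Lemma derivable_and P D1 D2 J1 J2 :
  all (is_sdnf w) P -> #|J1 :|: J2| <= w ->
  subsumed P (D1 :|: [set J1]) -> subsumed P (D2 :|: [set J2]) ->
  derivable P 1 (D1 :|: D2 :|: [set J1 :|: J2]).
Proof.
move=> gP wJ h1 h2.
have case1 D1' D2' J1' J2' : set0 \in D1' :|: [set J1'] ->
    subsumed P (D2' :|: [set J2']) ->
    derivable P 1 (D1' :|: D2' :|: [set J1' :|: J2']).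
  move=> /set0_in_U1 [h|->] h'; apply: subsumed_derivable.
    by left; rewrite !inE h.
  rewrite set0U; apply: sub_subsumed h' => //.
  by rewrite -setUA subsetUr.
case: h1 => [h1|[M1 M1P s1]]; first exact: case1.
case: h2 => [h2|[M2 M2P s2]].
  rewrite (setUC D1) (setUC J1); apply: case1 => //.
  by right; exists M1.
have [J1M|J1M] := boolP (J1 \in M1); last first.
  apply: subsumed_derivable; right; exists M1 => //.
  by rewrite -setUA; apply: subset_trans (subsetUl _ _); exact: subsetU_notin s1.
have [J2M|J2M] := boolP (J2 \in M2); last first.
  apply: subsumed_derivable; right; exists M2 => //.
  rewrite (setUC D1) -setUA; apply: subset_trans (subsetUl _ _).
  exact: subsetU_notin s2.
have /sdnfP w1 : is_sdnf w M1 by exact: (allP gP).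
have /sdnfP w2 : is_sdnf w M2 by exact: (allP gP).
apply: (@derivable_step _ _ (M1 :\ J1 :|: (M2 :\ J2) :|: [set J1 :|: J2])) => //.
- by apply/sdnfP => T; rewrite !inE => /orP[/orP[]/andP[_]|/eqP -> //];
    [move/w1|move/w2].
- by apply: res_and => //; rewrite D1U.
- by apply: setSU; apply: setUSS; exact: subD1U.
Qed.

Definition neg_set (J : {set literal V}) : {set literal V} :=
  [set neg_lit l | l in J].

Lemma neg_litK : involutive (@neg_lit V).
Proof. by case=> v b; rewrite /neg_lit /= negbK. Qed.

Lemma in_neg_set J l : (l \in neg_set J) = (neg_lit l \in J).
Proof.
apply/imsetP/idP => [[l' l'J ->]|h]; first by rewrite neg_litK.
by exists (neg_lit l) => //; rewrite neg_litK.
Qed.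

Lemma neg_setK : involutive neg_set.
Proof. by move=> J; apply/setP=> l; rewrite !in_neg_set neg_litK. Qed.

Lemma derivable_cut P D1 D2 J :
  all (is_sdnf w) P ->
  subsumed P (D1 :|: dnf_of_clause J) -> subsumed P (D2 :|: [set neg_set J]) ->
  derivable P 2 (D1 :|: D2).
Proof.
move=> gP [h1|[M1 M1P s1]] h2.
  apply: subsumed_derivable; left; move: h1; rewrite !inE => /orP[->//|].
  by case/imsetP=> l _ /setP /(_ l); rewrite !inE eqxx.
case: h2 => [|[M2 M2P s2]].
  move=> /set0_in_U1 [h|h]; apply: subsumed_derivable; first by left; rewrite !inE h orbT.
  right; exists M1 => //; apply: subset_trans s1 _; apply: setUS.
  have -> : J = set0.
    by apply/setP=> l; rewrite -(neg_setK J) h in_neg_set !inE.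
  by apply/subsetP => T /imsetP[l]; rewrite inE.
have [J2M|J2M] := boolP (neg_set J \in M2); last first.
  apply: subsumed_derivable; right; exists M2 => //.
  by apply: subset_trans (subsetUr _ _); exact: subsetU_notin s2.
have /sdnfP w1 : is_sdnf w M1 by exact: (allP gP).
have /sdnfP w2 : is_sdnf w M2 by exact: (allP gP).
(* [M1] contains only some of the literals of [J], so the dual term is first
   weakened accordingly. *)
pose J' := [set l in J | [set l] \in M1].
pose M2' := M2 :\ neg_set J :|: [set neg_set J'].
have sJ' : neg_set J' \subset neg_set J.
  by apply: imsetS; apply/subsetP=> l; rewrite inE => /andP[].
have wM2' : is_sdnf w M2'.
  apply/sdnfP => T; rewrite !inE => /orP[/andP[_ /w2]//|/eqP ->].
  exact: leq_trans (subset_leq_card sJ') (w2 _ J2M).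
(* Every term of [M1] outside [D1] is a literal of [J'], so [M1] is exactly [M1 :&: D1] together
   with the clause of [J']. *)
pose M := (M1 :&: D1) :|: (M2 :\ neg_set J).
have e1 : extends P [:: M2'].
  apply: extends1 => //; apply: (@res_weak_term _ _ _ _ _ (neg_set J)).
  by rewrite (setUidPr sJ') D1U.
have e2 : extends (P ++ [:: M2']) [:: M].
  apply: extends1.
    apply/sdnfP => T; rewrite !inE => /orP[/andP[/w1//]|/andP[_ /w2//]].
  apply: (@res_cut _ _ _ _ _ J'); last by rewrite mem_cat mem_seq1 eqxx orbT.
  rewrite mem_cat; apply/orP; left; suff -> : M1 :&: D1 :|: dnf_of_clause J' = M1 by [].
  apply/setP=> T; rewrite !inE; apply/orP/idP => [[/andP[]//|]|TM].
    by case/imsetP => l; rewrite inE => /andP[_ lM] ->.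
  have := subsetP s1 _ TM; rewrite !inE => /orP[->|/imsetP[l lJ eT]]; first by left; rewrite TM.
  by right; apply/imsetP; exists l => //; rewrite inE lJ -eT.
exists ([:: M2'] ++ [:: M]); split=> //; first exact: extends_cat.
right; exists M; first by rewrite !mem_cat !mem_seq1 eqxx !orbT.
by apply: setUSS; [exact: subsetIr | exact: subD1U].
Qed.

(** One [res_and] per term of [H]; a finished term moves into the side part [G] of the induction
    hypothesis. *)
Lemma derivable_multi_and P c (G G' H : dnf V) J :
  all (is_sdnf w) P -> #|H| <= c ->
  {in H, forall T, #|T :|: J| <= w} ->
  subsumed P (G :|: H) -> subsumed P (G' :|: [set J]) ->
  derivable P c (G :|: G' :|: [set T :|: J | T in H]).
Proof.
elim: c P G H => [|c IH] P G H gP.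
  rewrite leqn0 cards_eq0 => /eqP -> _ h _; apply: subsumed_derivable.
  by apply: sub_subsumed h => //; rewrite setU0 -setUA subsetUl.
move=> cH wH h h'.
have [H0|[T TH]] := set_0Vmem H.
  apply: subsumed_derivable; apply: sub_subsumed h => //.
  by rewrite H0 setU0 -setUA subsetUl.
rewrite -add1n.
apply: (derivable_bind gP).
  apply: (@derivable_and P (G :|: H :\ T) G' T J gP (wH _ TH) _ h').
  apply: sub_subsumed h => //.
  by rewrite -setUA; apply: setUS; rewrite D1U.
move=> P' gP' sP hP'.
have := IH P' (G :|: G' :|: [set T :|: J]) (H :\ T) gP'.
case.
- by rewrite -ltnS; apply: leq_trans cH; rewrite [X in _ <= X](cardsD1 T) TH.
- by move=> T'; rewrite !inE => /andP[_ /wH].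
- apply: sub_subsumed hP' => //; apply/subsetP=> X; rewrite !inE.
  by move=> /orP[/orP[/orP[->|->]|->]|->]; rewrite ?orbT.
- exact: sub_subsumed h'.
move=> q [eq sq hq]; exists q; split=> //; apply: sub_subsumed hq => //.
apply/subsetP => X; rewrite !inE.
move=> /orP[/orP[/orP[/orP[->//|->]|/eqP ->]|->]|].
- by rewrite orbT.
- by rewrite (imset_f (fun T => T :|: J)) // orbT.
- by rewrite orbT.
- by case/imsetP=> T'; rewrite !inE => /andP[_ T'H] ->; rewrite (imset_f (fun T => T :|: J)) // orbT.
Qed.

Lemma derivable_multi_weak P c (G H D : dnf V) :
  all (is_sdnf w) P -> #|H| <= c -> G \subset D ->
  {in H, forall T, exists2 T', T' \in D & T' \subset T} ->
  subsumed P (G :|: H) -> derivable P c D.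
Proof.
elim: c P G H => [|c IH] P G H gP.
  rewrite leqn0 cards_eq0 => /eqP -> sG _ h; apply: subsumed_derivable.
  by apply: sub_subsumed h => //; rewrite setU0.
move=> cH sG wH h.
have [H0|[T TH]] := set_0Vmem H.
  by apply: subsumed_derivable; apply: sub_subsumed h => //; rewrite H0 setU0.
have [T' T'D sT] := wH _ TH.
rewrite -add1n; apply: (derivable_bind gP).
  apply: (@derivable_weak_term _ (G :|: H :\ T) _ _ gP sT).
  by apply: sub_subsumed h => //; rewrite -setUA; apply: setUS; rewrite D1U.
move=> P' gP' sP hP'; apply: (IH P' (G :|: [set T']) (H :\ T)) => //.
- by rewrite -ltnS; apply: leq_trans cH; rewrite [X in _ <= X](cardsD1 T) TH.
- by rewrite subUset sG sub1set.
- by move=> X; rewrite !inE => /andP[_ /wH].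
- by apply: sub_subsumed hP' => //; rewrite setUAC.
Qed.

End Derivability.

(** * Branches of a line over a set of unset variables *)

Section Branching.
Variables (V : finType) (tau : restriction V).
Implicit Types (P : seq (dnf V)) (D : dnf V) (J T : term V) (Y : {set V}).
Implicit Types (Q : {set literal V}).

Definition consistent T : bool := [forall l in T, neg_lit l \notin T].

Definition true_lits : {set literal V} := [set l | tau l.1 == Some l.2].
Definition false_lits : {set literal V} := [set l | tau l.1 == Some (~~ l.2)].

Definition lits Y : {set literal V} := [set l | l.1 \in Y].

Definition free Y : Prop := {in Y, forall v, tau v = None}.

(* The calculus has no axioms [x \/ ~x], so [x] and [~x] are treated as
   independent atoms: [Q] is the set of literals over [Y] assumed false, all
   other literals over [Y] being assumed true. *)
Definition reduct Y Q D : dnf V :=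
  [set T :\: (true_lits :|: lits Y)
     | T in D & consistent T && [disjoint T & false_lits :|: Q]].

Definition branch_line Y Q D : dnf V := dnf_of_clause Q :|: reduct Y Q D.

(** Both literals of a variable may be assumed false, but never both true: simulating a cut requires
    that a literal assumed true has its negation assumed false. *)
Definition full Y Q : Prop :=
  Q \subset lits Y /\ {in Y, forall v, exists b, (v, b) \in Q}.

Definition satisfied D : bool :=
  [exists T in D, consistent T && (T \subset true_lits)].

(** Branching on [Y] makes the line fit the weaker calculus. Inconsistent or falsified terms are
    exempt because [reduct] drops them. *)
Definition covers (w : nat) Y D : Prop :=
  {in D, forall T, consistent T -> [disjoint T & false_lits] ->
     #|T :\: (true_lits :|: lits Y)| <= w}.

Lemma consistentP T :
  reflect {in T, forall l, neg_lit l \notin T} (consistent T).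
Proof. exact: forall_inP. Qed.

Lemma sub_consistent T T' : T \subset T' -> consistent T' -> consistent T.
Proof.
move=> /subsetP sT /consistentP c; apply/consistentP => l /sT lT.
by apply: contra (c _ lT); exact: sT.
Qed.

Lemma consistent1 l : consistent [set l].
Proof.
apply/consistentP => l' /set1P ->; rewrite inE; apply/eqP => -[].
by case: l => v [].
Qed.

Lemma card_lits Y : #|lits Y| = 2 * #|Y|.
Proof.
have -> : lits Y = setX Y [set: bool].
  by apply/setP => -[v b]; rewrite !inE andbT.
by rewrite cardsX cardsT card_bool mulnC.
Qed.

Lemma reductP Y Q D T :
  reflect (exists T0, [/\ T0 \in D, consistent T0,
             [disjoint T0 & false_lits :|: Q]
             & T = T0 :\: (true_lits :|: lits Y)]) (T \in reduct Y Q D).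
Proof.
apply: (iffP imsetP) => [[T0]|[T0 [h1 h2 h3 ->]]].
  by rewrite inE => /and3P[? ? ?] ->; exists T0.
by exists T0 => //; rewrite inE h1 h2.
Qed.

Lemma card_reduct Y Q D : #|reduct Y Q D| <= #|D|.
Proof.
apply: leq_trans (leq_imset_card _ _) _; apply: subset_leq_card.
by apply/subsetP => T; rewrite inE => /andP[].
Qed.

Lemma reductU Y Q D1 D2 :
  reduct Y Q (D1 :|: D2) = reduct Y Q D1 :|: reduct Y Q D2.
Proof.
apply/setP => T; apply/reductP/setUP => [[T0 [/setUP[] h1 h2 h3 ->]]|].
- by left; apply/reductP; exists T0.
- by right; apply/reductP; exists T0.
case=> /reductP[T0 [h1 h2 h3 ->]]; exists T0; split=> //; rewrite inE h1 //.
by rewrite orbT.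
Qed.

Lemma reduct1 Y Q J :
  reduct Y Q [set J] =
    if consistent J && [disjoint J & false_lits :|: Q]
    then [set J :\: (true_lits :|: lits Y)] else set0.
Proof.
apply/setP => T; apply/reductP/idP => [[T0 [/set1P -> -> -> ->]]|].
  by rewrite inE.
case: ifP; last by rewrite inE.
by move=> /andP[c d] /set1P ->; exists J; rewrite inE eqxx.
Qed.

Lemma branch_lineU Y Q D1 D2 :
  branch_line Y Q (D1 :|: D2) = branch_line Y Q D1 :|: reduct Y Q D2.
Proof. by rewrite /branch_line reductU setUA. Qed.

Lemma disjoint_inP (A B : {set literal V}) :
  reflect {in A, forall l, l \notin B} [disjoint A & B].
Proof.
apply: (iffP pred0P) => [h l lA|h l].
  by have := h l; rewrite /= lA /= => ->.
by rewrite /=; apply/negbTE; rewrite negb_and; case: (boolP (l \in A)) => // /h.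
Qed.

Lemma free_true_lits Y l : free Y -> l.1 \in Y -> l \notin true_lits.
Proof. by move=> f /f; rewrite inE => ->. Qed.

Lemma satisfied_branch_line Y Q D :
  free Y -> Q \subset lits Y -> satisfied D -> set0 \in branch_line Y Q D.
Proof.
move=> fY /subsetP sQ /exists_inP[T TD /andP[c /subsetP sT]].
rewrite inE; apply/orP; right; apply/reductP; exists T; split=> //.
  apply/disjoint_inP => l /[dup] lT /sT; rewrite !inE => /eqP e.
  rewrite e negb_or; apply/andP; split; first by case: (l.2).
  by apply/negP => /sQ; rewrite inE => /fY; rewrite e.
by apply/esym/eqP; rewrite setD_eq0; apply/subsetP => l /sT lt; rewrite inE lt.
Qed.

(** One weakening per term: a term with a literal in [Q] is weakened to that literal, which the
    clause of [Q] contains; any other term loses its literals over [Y]. *)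
Lemma branch_line_refine (w : nat) P c Y Y' Q D :
  all (is_sdnf w) P -> #|D| <= c -> Y' \subset Y ->
  subsumed P (branch_line Y' (Q :&: lits Y') D) ->
  Q \subset lits Y -> free Y ->
  derivable w P c (branch_line Y Q D).
Proof.
move=> gP cD /subsetP sY h /subsetP sQ fY; move: h.
apply: derivable_multi_weak => //; first exact: leq_trans (card_reduct _ _ _) _.
  apply: subset_trans (subsetUl _ _); apply/subsetP => T /imsetP[l].
  by rewrite inE => /andP[lQ _] ->; apply/imsetP; exists l.
move=> T /reductP[T0 [T0D c0 /disjoint_inP d0 ->]].
have [dQ|] := boolP [disjoint T0 & Q].
  exists (T0 :\: (true_lits :|: lits Y)).
    rewrite inE; apply/orP; right; apply/reductP; exists T0; split=> //.
    apply/disjoint_inP => l lT; have := d0 _ lT; rewrite !inE !negb_or.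
    by case/andP=> -> _ /=; exact: (disjoint_inP _ _ dQ).
  apply: setDS; apply: setUS; apply/subsetP=> l; rewrite !inE; exact: sY.
case/pred0Pn => l /= /andP[lT lQ]; exists [set l].
  by rewrite inE; apply/orP; left; apply/imsetP; exists l.
have := d0 _ lT; rewrite sub1set !inE lT lQ /= !negb_or andbT => /andP[_ ->].
by rewrite andbT; have := sQ _ lQ; rewrite inE => /(free_true_lits fY); rewrite inE.
Qed.

End Branching.

(** * Simulation of one inference inside a fixed branch *)

Section Simulation.
Variables (V : finType) (w d K : nat) (tau : restriction V).
Implicit Types (P : seq (dnf V)) (D : dnf V) (J T : term V) (Y : {set V}).
Implicit Types (Q : {set literal V}).

Local Notation branch_line := (branch_line tau).
Local Notation reduct := (reduct tau).
Local Notation free := (free tau).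
Local Notation good := (all (is_sdnf w)).

(** The condition on the empty line makes the empty line its own only branch, so that the translated
    derivation ends in a refutation. *)
Definition simulated P D : Prop :=
  satisfied tau D \/
  exists Y, [/\ free Y, #|Y| <= d, D = set0 -> Y = set0
              & forall Q, full Y Q -> subsumed P (branch_line Y Q D)].

Lemma sub_simulated P P' D :
  {subset P <= P'} -> simulated P D -> simulated P' D.
Proof.
move=> sP [h|[Y [h1 h2 h3 h]]]; [by left|right; exists Y; split=> //].
by move=> Q /h; apply: sub_subsumed.
Qed.

Definition branches_derivable P c Y D : Prop :=
  forall P' Q, {subset P <= P'} -> good P' -> full Y Q ->
    derivable w P' c (branch_line Y Q D).

Lemma simulated_branches P D :
  #|D| <= K -> simulated P D ->
  exists Y1, [/\ free Y1, #|Y1| <= d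
    & forall Y, free Y -> Y1 \subset Y -> branches_derivable P K Y D].
Proof.
move=> cD [h|[Y [h1 h2 _ h]]].
  exists set0; split; rewrite ?cards0 //; first by move=> v; rewrite inE.
  move=> Y fY _ P' Q sP gP' [sQ _]; apply: subsumed_derivable; left.
  exact: satisfied_branch_line.
exists Y; split=> // Y' fY' sY P' Q sP gP' [sQ fQ].
apply: (branch_line_refine gP' cD sY) => //.
apply: (sub_subsumed sP (subxx _)); apply: h; split; first exact: subsetIr.
move=> v vY; have [b hb] := fQ v (subsetP sY v vY); exists b.
by rewrite !inE hb.
Qed.

Section Rules.
Variables (P : seq (dnf V)) (Y : {set V}) (Q : {set literal V}).
Hypotheses (gP : good P) (fY : free Y) (fQ : full Y Q).

Let O := false_lits tau :|: Q.
Let Z := true_lits tau :|: lits Y.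

(** The form of complementation that holds in a branch, because [full] excludes that both literals
    of a variable are assumed true. *)
Lemma neg_assumed_false l : l \in Z -> l \notin O -> neg_lit l \in O.
Proof.
rewrite !inE /= negbK => /orP[->//|lY]; rewrite negb_or => /andP[_ lQ].
apply/orP; right; have [b] := fQ.2 _ lY.
case: l lQ lY => v b' /= lQ _ h; rewrite /neg_lit /=.
by have [e|e] := eqVneq b b'; [rewrite -e h in lQ | suff -> : ~~ b' = b by []; case: b b' e {h lQ} => [] []].
Qed.

Lemma rule_and D1 D2 J1 J2 :
  covers tau w Y [set J1 :|: J2] ->
  subsumed P (branch_line Y Q (D1 :|: [set J1])) ->
  subsumed P (branch_line Y Q (D2 :|: [set J2])) ->
  derivable w P 4 (branch_line Y Q (D1 :|: D2 :|: [set J1 :|: J2])).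
Proof.
move=> cv; rewrite !branch_lineU !reduct1 -/O -/Z.
case: ifP => [/andP[c1 d1]|_]; last first.
  rewrite setU0 => h _; apply: subsumed_derivable; apply: sub_subsumed h => //.
  exact: subset_trans (subsetUl _ _) (subsetUl _ _).
case: ifP => [/andP[c2 d2]|_]; last first.
  rewrite setU0 => _ h; apply: subsumed_derivable; apply: sub_subsumed h => //.
  by apply/subsetP => T; rewrite !inE => /orP[->|->]; rewrite ?orbT.
have d12 : [disjoint J1 :|: J2 & O].
  apply/disjoint_inP => l /setUP[]; [exact: (disjoint_inP _ _ d1)|exact: (disjoint_inP _ _ d2)].
rewrite d12 andbT; case: ifP => [c12|/negbT c12] h1 h2.
  have hw : #|(J1 :\: Z) :|: (J2 :\: Z)| <= w.
    rewrite -setDUl; apply: cv; rewrite ?inE //.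
    by apply/disjoint_inP => l /(disjoint_inP _ _ d12); rewrite inE negb_or => /andP[].
  apply: derivable_sub (derivable_and gP hw h1 h2) => //.
  rewrite setDUl /branch_line; apply: setSU; apply/subsetP => T.
  by rewrite !inE => /orP[/orP[->|->]|/orP[->|->]]; rewrite ?orbT.
rewrite setU0.
(* The contradictory term vanishes from the branch of the conclusion. The premises are weakened to
   clashing literals [l] and [neg_lit l], which are then cut. *)
have [l l1 l2] : exists2 l, l \in J1 & neg_lit l \in J2.
  move: c12; rewrite negb_forall => /existsP[l]; rewrite negb_imply negbK.
  move=> /andP[/setUP[] lJ /setUP[] nJ]; last 2 first.
  - by exists (neg_lit l) => //; rewrite neg_litK.
  - by move/consistentP: c2 => /(_ _ lJ); rewrite nJ.
  - by move/consistentP: c1 => /(_ _ lJ); rewrite nJ.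
  - by exists l.
have lO := disjoint_inP _ _ d1 _ l1; have nO := disjoint_inP _ _ d2 _ l2.
have lZ : l \notin Z by apply: contra nO => lZ; exact: neg_assumed_false.
have nZ : neg_lit l \notin Z.
  by apply: contra lO => nZ; rewrite -[l]neg_litK; exact: neg_assumed_false.
apply: (@derivable_bind _ _ _ 1 3 (branch_line Y Q D1 :|: [set [set l]])) => //.
  by apply: derivable_weak_term h1 => //; rewrite sub1set inE lZ.
move=> P1 gP1 sP1 h1'.
apply: (@derivable_bind _ _ _ 1 2 (branch_line Y Q D2 :|: [set [set neg_lit l]])) => //.
  apply: (@derivable_weak_term _ _ _ _ _ (J2 :\: Z)) => //; first by rewrite sub1set inE nZ.
  exact: sub_subsumed h2.
move=> P2 gP2 sP2 h2'.
apply: derivable_sub (@derivable_cut _ _ P2 (branch_line Y Q D1) (branch_line Y Q D2) [set l] gP2 _ _) => //.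
- by apply/subsetP => T; rewrite !inE => /orP[|] /orP[->|->]; rewrite ?orbT.
- by apply: sub_subsumed h1' => //; rewrite /dnf_of_clause imset_set1.
- by rewrite /neg_set imset_set1.
Qed.

(** If the dual term is dropped, the second premise suffices. Otherwise none of its literals is
    false, so each literal of [J] surviving as a term lies outside [Z] together with its negation,
    and what remains is a cut on the undecided part of [J]. *)
Lemma rule_cut D1 D2 J :
  subsumed P (branch_line Y Q (D1 :|: dnf_of_clause J)) ->
  subsumed P (branch_line Y Q (D2 :|: [set neg_set J])) ->
  derivable w P 4 (branch_line Y Q (D1 :|: D2)).
Proof.
rewrite !branch_lineU !reduct1 -/O -/Z => h1.
case: ifP => [/andP[cJ dJ]|_]; last first.
  rewrite setU0 => h; apply: subsumed_derivable; apply: sub_subsumed h => //.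
  by apply/subsetP => T; rewrite !inE => /orP[->|->]; rewrite ?orbT.
move=> h2.
pose J' := neg_set (neg_set J :\: Z).
apply: (@derivable_sub _ _ _ 2 4 (branch_line Y Q D1 :|: branch_line Y Q D2)) => //.
  by apply/subsetP => T; rewrite !inE => /orP[|] /orP[->|->]; rewrite ?orbT.
apply: (@derivable_cut _ _ _ _ _ J') => //; last by rewrite neg_setK.
apply: sub_subsumed h1 => //; apply: setUS.
apply/subsetP => T /reductP[T0 [/imsetP[l lJ ->] _ d0 ->]] {T0}.
have lO : l \notin O by apply: (disjoint_inP _ _ d0); rewrite inE.
have nO : neg_lit l \notin O.
  by apply: (disjoint_inP _ _ dJ); rewrite in_neg_set neg_litK.
have lZ : l \notin Z by apply: contra nO => lZ; exact: neg_assumed_false.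
have nZ : neg_lit l \notin Z.
  by apply: contra lO => nZ; rewrite -[l]neg_litK; exact: neg_assumed_false.
apply/imsetP; exists l.
  by rewrite in_neg_set inE nZ in_neg_set neg_litK lJ.
apply/setP => l'; rewrite in_setD in_set1; have [->|] := eqVneq l' l.
  by rewrite lZ.
by rewrite andbF.
Qed.

Lemma rule_weak_term D J1 J2 :
  subsumed P (branch_line Y Q (D :|: [set J1 :|: J2])) ->
  derivable w P 4 (branch_line Y Q (D :|: [set J1])).
Proof.
rewrite !branch_lineU !reduct1 -/O -/Z.
case: ifP => [/andP[c12 d12]|_] h; last first.
  apply: subsumed_derivable; apply: sub_subsumed h => //.
  by rewrite setU0 subsetUl.
rewrite (sub_consistent _ c12) ?subsetUl //=.
have -> : [disjoint J1 & O].
  by apply/disjoint_inP => l lJ; apply: (disjoint_inP _ _ d12); rewrite inE lJ.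
apply: (@derivable_sub _ _ _ 1 4) (subxx _) _ => //.
by apply: derivable_weak_term h => //; apply: setSD; exact: subsetUl.
Qed.

End Rules.

Lemma free_union Y1 Y2 : free Y1 -> free Y2 -> free (Y1 :|: Y2).
Proof. by move=> f1 f2 v /setUP[/f1|/f2]. Qed.

(** Both premises are refined to a common branching set at [K] steps each; the rule then takes at
    most 4 steps in each branch. *)
Lemma step_branches (s : nat) P P0 D :
  res_step s P0 D -> {in P0, forall D', #|D'| <= K /\ simulated P D'} ->
  exists Y1, [/\ free Y1, #|Y1| <= 2 * d
    & forall Y, free Y -> Y1 \subset Y -> covers tau w Y D ->
      branches_derivable P (2 * K + 4) Y D].
Proof.
move=> st sim.
have two A B : A \in P0 -> B \in P0 ->
    (forall Y P' Q, free Y -> covers tau w Y D -> good P' -> full Y Q ->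
      subsumed P' (branch_line Y Q A) -> subsumed P' (branch_line Y Q B) ->
      derivable w P' 4 (branch_line Y Q D)) ->
    exists Y1, [/\ free Y1, #|Y1| <= 2 * d
      & forall Y, free Y -> Y1 \subset Y -> covers tau w Y D ->
        branches_derivable P (2 * K + 4) Y D].
  move=> /sim[cA sA] /sim[cB sB] rule.
  have [YA [fA dA hA]] := simulated_branches cA sA.
  have [YB [fB dB hB]] := simulated_branches cB sB.
  exists (YA :|: YB); split; first exact: free_union.
    by rewrite mul2n -addnn; apply: leq_trans (leq_card_setU _ _) _; exact: leq_add.
  move=> Y fY; rewrite subUset => /andP[sYA sYB] cv P' Q sP gP' fQ.
  have -> : 2 * K + 4 = K + (K + 4) by lia.
  apply: (derivable_bind gP'); first exact: (hA Y fY sYA P' Q sP gP' fQ).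
  move=> P1 gP1 sP1 h1; apply: (derivable_bind gP1).
    by apply: (hB Y fY sYB P1 Q _ gP1 fQ) => M /sP /sP1.
  move=> P2 gP2 sP2 h2; apply: (rule Y) => //.
  exact: sub_subsumed h1.
have sub_cov D' Y : D' \subset D -> covers tau w Y D -> covers tau w Y D'.
  by move=> /subsetP sD cv T /sD; exact: cv.
case: st two sub_cov; [move=> D1 D2 J1 J2 m1 m2 _|move=> D1 D2 J m1 m2
  |move=> D' J m1 _|move=> D' J1 J2 m1]; move=> two sub_cov.
- apply: (two _ _ m1 m2) => Y P' Q fY cv gP' fQ h1 h2.
  by apply: rule_and => //; apply: sub_cov cv; exact: subsetUr.
- by apply: (two _ _ m1 m2) => Y P' Q fY cv gP' fQ h1 h2; exact: rule_cut h1 h2.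
- apply: (two _ _ m1 m1) => Y P' Q fY cv gP' fQ h1 h2.
  apply: subsumed_derivable; apply: sub_subsumed h1 => //.
  by rewrite branch_lineU subsetUl.
- by apply: (two _ _ m1 m1) => Y P' Q fY cv gP' fQ h1 h2; exact: rule_weak_term h1.
Qed.

End Simulation.

(** * Merging branches: elimination of branching variables *)

Section Merging.
Variables (V : finType) (w K : nat) (tau : restriction V).
Implicit Types (P : seq (dnf V)) (D : dnf V) (J T : term V) (Y : {set V}).
Implicit Types (Q : {set literal V}).

Local Notation branch_line := (branch_line tau).
Local Notation free := (free tau).
Local Notation good := (all (is_sdnf w)).

(* Distributivity, with [x] and [~x] as atoms: a DNF [(x & A) | (~x & B) | C]
   follows from [x | B | C], [~x | A | C] and [x | ~x | C]. *)
Lemma branch_line_merge P Y Q D v :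
  good P -> #|D| <= K -> free (v |: Y) -> v \notin Y -> covers tau w Y D ->
  Q \subset lits Y ->
  subsumed P (branch_line (v |: Y) ((v, true) |: Q) D) ->
  subsumed P (branch_line (v |: Y) ((v, false) |: Q) D) ->
  subsumed P (branch_line (v |: Y) ((v, true) |: ((v, false) |: Q)) D) ->
  derivable w P (3 * K + 2) (branch_line Y Q D).
Proof.
move=> gP cD fvY vY cv /subsetP sQ.
pose x : literal V := (v, true); pose y : literal V := (v, false).
pose W := true_lits tau :|: lits (v |: Y).
pose alive T := consistent T && [disjoint T & false_lits tau :|: Q].
pose R0 := [set T :\: W | T in D & [&& alive T, x \notin T & y \notin T]].
pose R l := [set T :\: W | T in D & alive T && (l \in T)].
pose G0 := dnf_of_clause Q :|: R0.
have tv : tau v = None by apply: fvY; rewrite !inE eqxx.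
have fY : free Y by move=> v' v'Y; apply: fvY; rewrite inE v'Y orbT.
have cR l : #|R l| <= K.
  apply: leq_trans (leq_imset_card _ _) (leq_trans (subset_leq_card _) cD).
  by apply/subsetP => T; rewrite inE => /andP[].
have add_back T l : consistent T -> l \in T -> l.1 = v ->
    T :\: W :|: [set l] = T :\: (true_lits tau :|: lits Y).
  move=> cT lT lv; apply/setP => l'; rewrite !inE.
  have [->|ne] := eqVneq l' l; first by rewrite lv tv (negPf vY) lT orbT.
  rewrite orbF; case l'T : (l' \in T); rewrite ?andbF // !andbT.
  suff -> : (l'.1 == v) = false by [].
  apply/negP => /eqP l'v; move/consistentP: cT => /(_ _ lT).
  suff -> : neg_lit l = l' by rewrite l'T.
  clear -lv l'v ne; case: l l' lv l'v ne => [a b] [a' b'] /= -> ->.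
  by rewrite /neg_lit /=; case: b b' => [] []; rewrite ?eqxx.
have target l : l.1 = v -> [set T :|: [set l] | T in R l] \subset branch_line Y Q D.
  move=> lv; apply/subsetP => X /imsetP[T' /imsetP[T]].
  rewrite inE => /and3P[TD /andP[cT dT] lT] -> -> {X T'}.
  by rewrite inE; apply/orP; right; apply/reductP; exists T; split=> //; exact: add_back.
have G0_target : G0 \subset branch_line Y Q D.
  apply: setUS; apply/subsetP => X /imsetP[T].
  rewrite inE => /and4P[TD /andP[cT dT] xT yT] -> {X}.
  apply/reductP; exists T; split=> //; apply/setP => l; rewrite !inE.
  case lT : (l \in T); rewrite ?andbF // !andbT.
  suff -> : (l.1 == v) = false by [].
  apply/negP => /eqP lv; case: l lv lT => [a []] /= -> lT.
    by rewrite lT in xT.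
  by rewrite lT in yT.
have wR l : l.1 = v -> {in R l, forall T, #|T :|: [set l]| <= w}.
  move=> lv X /imsetP[T]; rewrite inE => /and3P[TD /andP[cT /disjoint_inP dT] lT] -> {X}.
  rewrite add_back //; apply: cv => //; apply/disjoint_inP => l' /dT.
  by rewrite inE negb_or => /andP[].
have line (S : {set literal V}) : S \subset [set x; y] ->
    branch_line (v |: Y) (S :|: Q) D \subset
    G0 :|: dnf_of_clause S :|: (if x \in S then set0 else R x)
      :|: (if y \in S then set0 else R y).
  move=> /subsetP sS; apply/subsetP => T /setUP[/imsetP[l]|].
    move=> /setUP[lS|lQ] ->; rewrite !in_setU.
      by rewrite (_ : [set l] \in dnf_of_clause S) ?orbT //; apply/imsetP; exists l.
    by rewrite (_ : [set l] \in dnf_of_clause Q) //; apply/imsetP; exists l.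
  move=> /reductP[T0 [TD cT /disjoint_inP dT ->]].
  have aT : alive T0.
    rewrite /alive cT; apply/disjoint_inP => l /dT; rewrite !inE !negb_or.
    by case/and3P=> -> _ ->.
  have nS l : l \in T0 -> l \notin S.
    by move=> /dT; rewrite !inE !negb_or => /and3P[].
  rewrite !in_setU.
  have [xT|xT] := boolP (x \in T0).
    rewrite (negPf (nS _ xT)) (_ : T0 :\: _ \in R x) ?orbT //.
    by apply/imsetP; exists T0 => //; rewrite inE TD aT.
  have [yT|yT] := boolP (y \in T0).
    rewrite (negPf (nS _ yT)) (_ : T0 :\: _ \in R y) ?orbT //.
    by apply/imsetP; exists T0 => //; rewrite inE TD aT.
  rewrite (_ : T0 :\: _ \in R0) ?orbT //.
  by apply/imsetP; exists T0 => //; rewrite inE TD aT xT.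
have yx : (y == x) = false by apply/eqP => -[].
move=> /sub_subsumed hx /sub_subsumed hy /sub_subsumed hxy.
have {}hx : subsumed P (G0 :|: R y :|: [set [set x]]).
  apply: hx => //; apply: subset_trans (line [set x] _) _.
    by apply/subsetP => l; rewrite !inE => ->.
  rewrite !inE eqxx /= /dnf_of_clause imset_set1 setU0.
  by rewrite yx setUAC.
have {}hy : subsumed P (G0 :|: [set [set y]] :|: R x).
  apply: hy => //; apply: subset_trans (line [set y] _) _.
    by apply/subsetP => l; rewrite !inE => ->; rewrite orbT.
  by rewrite !inE eqxx /= /dnf_of_clause imset_set1 setU0 eq_sym yx.
have {}hxy : subsumed P (G0 :|: [set [set y]] :|: [set [set x]]).
  apply: hxy => //; rewrite setUA; apply: subset_trans (line [set x; y] _) _ => //.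
  rewrite !inE eqxx eqxx orbT /= !setU0 -setUA; apply: setUS.
  rewrite /dnf_of_clause imsetU !imset_set1 setUC; exact: subxx.
have -> : 3 * K + 2 = K + (2 + (K + K)) by lia.
(* Four stages: [hy] and [hxy] attach [x] to [R x] next to the term [y]; a cut of [hx] and [hy] on
   [x] leaves [R x] and [R y]; [hx] attaches [x] to [R x] there; the line of the first stage
   attaches [y] to [R y]. Three passes of [K] steps and one cut give the cost. *)
apply: (@derivable_bind _ _ _ _ _ (G0 :|: [set [set y]] :|: [set T :|: [set x] | T in R x])) => //.
  apply: derivable_sub (derivable_multi_and gP (cR x) (wR x _) hy hxy) => //.
  by rewrite setUid.
move=> P1 gP1 s1 h1.
apply: (@derivable_bind _ _ _ _ _ (G0 :|: R y :|: R x)) => //.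
  apply: (@derivable_sub _ _ _ 2 2 ((G0 :|: R y) :|: (G0 :|: R x))) => //.
    apply/subsetP => T; rewrite !in_setU.
    by move=> /orP[|] /orP[] ->; rewrite ?orbT.
  apply: (@derivable_cut _ _ _ _ _ [set x]) => //.
    by rewrite /dnf_of_clause imset_set1; exact: sub_subsumed hx.
  by rewrite /neg_set imset_set1 setUAC; exact: sub_subsumed hy.
move=> P2 gP2 s2 h2.
apply: (@derivable_bind _ _ _ _ _ (G0 :|: R y :|: [set T :|: [set x] | T in R x])) => //.
  apply: (@derivable_sub _ _ _ K K (G0 :|: R y :|: (G0 :|: R y) :|: [set T :|: [set x] | T in R x])) => //.
    by rewrite setUid.
  apply: (derivable_multi_and gP2 (cR x) (wR x _)) => //.
  by apply: sub_subsumed hx => // M /s1 /s2.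
move=> P3 gP3 s3 h3.
apply: (@derivable_sub _ _ _ K K ((G0 :|: [set T :|: [set x] | T in R x]) :|: (G0 :|: [set T :|: [set x] | T in R x]) :|: [set T :|: [set y] | T in R y])) => //.
  rewrite setUid; apply/subsetP => T /setUP[/setUP[]|].
  - exact: (subsetP G0_target).
  - exact: (subsetP (target x _)).
  - exact: (subsetP (target y _)).
apply: (derivable_multi_and gP3 (cR y) (wR y _)) => //.
  by rewrite setUAC.
rewrite setUAC; apply: sub_subsumed h1 => // M /s2 /s3 //.
Qed.

(** Variables are removed one at a time. Three branches, plus a merge that costs no more than one of
    them, give the factor 4 per variable. *)
Lemma branches_derivable_merge P c Y Y' D :
  #|D| <= K -> free Y -> Y' \subset Y -> covers tau w Y' D ->
  branches_derivable w tau P c Y D ->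
  branches_derivable w tau P (4 ^ #|Y :\: Y'| * (c + (3 * K + 2))) Y' D.
Proof.
move=> cD fY; move en : #|Y :\: Y'| => k; elim: k Y' en => [|k IH] Y' en sY cv h.
  have <- : Y = Y'.
    apply/eqP; rewrite eqEsubset sY andbT -setD_eq0 -cards_eq0; exact/eqP.
  move=> P' Q sP gP' fQ; apply: derivable_sub (h P' Q sP gP' fQ) => //.
  by rewrite mul1n leq_addr.
have [Y0|[v]] := set_0Vmem (Y :\: Y'); first by rewrite Y0 cards0 in en.
rewrite inE => /andP[vY' vY].
have svY : v |: Y' \subset Y by rewrite subUset sub1set vY.
have {}IH : branches_derivable w tau P (4 ^ k * (c + (3 * K + 2))) (v |: Y') D.
  apply: IH => //.
    have -> : Y :\: (v |: Y') = (Y :\: Y') :\ v.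
      by apply/setP=> v'; rewrite !inE negb_or; case: eqP => //=.
    by have := cardsD1 v (Y :\: Y'); rewrite en inE vY vY' => -[].
  move=> T TD cT dT; apply: leq_trans (subset_leq_card _) (cv T TD cT dT).
  by apply: setDS; apply: setUS; apply/subsetP => l; rewrite !inE => ->; rewrite orbT.
move=> P' Q sP gP' [sQ fQ].
have full_add (S : {set literal V}) : S \subset lits [set v] -> S != set0 -> full (v |: Y') (S :|: Q).
  move=> /subsetP sS /set0Pn[l lS]; split.
    apply/subsetP => l' /setUP[/sS|/(subsetP sQ)]; rewrite !inE => -> //.
    by rewrite orbT.
  move=> v' /setU1P[->|/fQ[b hb]]; last by exists b; rewrite inE hb orbT.
  have := sS _ lS; case: l lS => a b lS; rewrite !inE /= => /eqP <-.
  by exists b; rewrite inE lS.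
have in_v b : [set ((v, b) : literal V)] \subset lits [set v] by rewrite sub1set !inE.
have nz b : [set ((v, b) : literal V)] != set0 by apply/set0Pn; exists (v, b); rewrite inE.
set f := 4 ^ k * _ in IH *.
apply: (@derivable_sub _ _ _ (f + (f + (f + (3 * K + 2)))) _ (branch_line Y' Q D)) => //.
  have : 3 * K + 2 <= f.
    by apply: leq_trans (leq_addl c _) _; rewrite /f leq_pmull // expn_gt0.
  by rewrite expnS -mulnA -/f; lia.
apply: (derivable_bind gP').
  by apply: (IH P' ([set (v, true)] :|: Q)) => //; exact: full_add.
move=> P1 gP1 s1 h1; apply: (derivable_bind gP1).
  by apply: (IH P1 ([set (v, false)] :|: Q)) => //; [move=> M /sP /s1|exact: full_add].
move=> P2 gP2 s2 h2; apply: (derivable_bind gP2).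
  apply: (IH P2 ([set (v, true)] :|: ([set (v, false)] :|: Q))) => //; first by move=> M /sP /s1 /s2.
  rewrite setUA; apply: full_add; first by rewrite subUset !in_v.
  by apply/set0Pn; exists (v, true); rewrite !inE eqxx.
move=> P3 gP3 s3 h3; apply: (branch_line_merge gP3 cD _ vY' cv sQ _ _ h3).
- by move=> v' /(subsetP svY) /fY.
- by apply: sub_subsumed h1 => // M /s2 /s3.
- exact: sub_subsumed h2.
Qed.

End Merging.

(** * Translation of a whole refutation, and the number of terms per line *)

Section Refutation.
Variables (V : finType) (s w d K : nat) (tau : restriction V).
Implicit Types (P : seq (dnf V)) (D : dnf V) (Y : {set V}).
Implicit Types (Q : {set literal V}).

Lemma derivable_all P c (xs : seq (dnf V)) :
  all (is_sdnf w) P ->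
  (forall P', all (is_sdnf w) P' -> {subset P <= P'} ->
     {in xs, forall x, derivable w P' c x}) ->
  exists q, [/\ extends w P q, size q <= size xs * c
    & {in xs, forall x, subsumed (P ++ q) x}].
Proof.
elim: xs P => [|x xs IH] P gP h.
  by exists [::]; split=> // i; rewrite ltn0.
have [q [e sq hq]] := h P gP (fun _ => id) x (mem_head _ _).
have gP' := extends_sdnf gP e.
have sP : {subset P <= P ++ q} by move=> M MP; rewrite mem_cat MP.
have [q' [e' sq' hq']] : exists q', [/\ extends w (P ++ q) q', size q' <= size xs * c
    & {in xs, forall x, subsumed ((P ++ q) ++ q') x}].
  apply: IH => // P' gP'' sP' x' x'xs; apply: h => //.
    by move=> M /sP /sP'.
  by rewrite inE x'xs orbT.
exists (q ++ q'); split; first exact: extends_cat.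
  by rewrite size_cat mulSn leq_add.
rewrite catA => x'; rewrite inE => /orP[/eqP ->|/hq' //].
exact: subsumed_catl.
Qed.

(** [4 ^ d] bounds the number of sets [Q] of literals over [d] variables, [4 ^ (2 * d)] pays for
    merging away the variables of two premises, and [5 * K + 6] is [2 * K + 4] for the inference
    plus [3 * K + 2] for a merge. *)
Definition step_cost : nat := 4 ^ d * (4 ^ (2 * d) * (5 * K + 6)).

Lemma simulated_step P P0 D Y :
  all (is_sdnf w) P -> res_step s P0 D ->
  {in P0, forall D', #|D'| <= K /\ simulated d tau P D'} ->
  #|D| <= K -> free tau Y -> #|Y| <= d -> (D = set0 -> Y = set0) ->
  covers tau w Y D ->
  exists q, [/\ extends w P q, size q <= step_cost
    & simulated d tau (P ++ q) D].
Proof.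
move=> gP st sim cD fY dY Y0 cv.
have [Y1 [f1 d1 h1]] := @step_branches _ w _ _ _ _ _ _ _ st sim.
have fU : free tau (Y1 :|: Y) := free_union f1 fY.
have cvU : covers tau w (Y1 :|: Y) D.
  move=> T TD cT dT; apply: leq_trans (subset_leq_card _) (cv T TD cT dT).
  by apply: setDS; apply: setUS; apply/subsetP => l; rewrite !inE => ->; rewrite orbT.
have h2 := branches_derivable_merge cD fU (subsetUr _ _) cv
  (h1 _ fU (subsetUl _ _) cvU).
pose xs := [seq branch_line tau Y Q D | Q <- enum (powerset (lits Y)) &
  [forall v in Y, exists b, (v, b) \in Q]].
have [|q [e sq hq]] := @derivable_all P (4 ^ (2 * d) * (5 * K + 6)) xs gP.
  move=> P' gP' sP x /mapP[Q]; rewrite mem_filter => /andP[/forall_inP fQ].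
  rewrite mem_enum inE => sQ -> {x}.
  apply: derivable_sub (h2 P' Q sP gP' _) => //.
    have -> : 2 * K + 4 + (3 * K + 2) = 5 * K + 6 by lia.
    rewrite leq_mul2r leq_exp2l //; apply/orP; right.
    apply: leq_trans (subset_leq_card _) d1.
    by apply/subsetP => v; rewrite !inE => /andP[/negPf ->]; rewrite orbF.
  by split=> // v /fQ /existsP[b hb]; exists b.
exists q; split=> //.
  apply: leq_trans sq _; rewrite leq_mul2r; apply/orP; right.
  rewrite size_map size_filter; apply: leq_trans (count_size _ _) _.
  rewrite -cardE card_powerset card_lits expnM.
  by rewrite leq_exp2l.
right; exists Y; split=> // Q [sQ fQ]; apply: hq; apply: map_f.
rewrite mem_filter mem_enum inE sQ andbT; apply/forall_inP => v /fQ[b hb].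
by apply/existsP; exists b.
Qed.

Lemma simulated_refutation (A A' prf : seq (dnf V)) :
  extends s A prf -> all (is_sdnf w) A' ->
  {in A, forall D, #|D| <= K /\ simulated d tau A' D} ->
  {in prf, forall D, #|D| <= K /\ (satisfied tau D \/
     exists Y, [/\ free tau Y, #|Y| <= d, D = set0 -> Y = set0
                 & covers tau w Y D])} ->
  set0 \in A ++ prf ->
  exists q, [/\ extends w A' q, size q <= size prf * step_cost
    & set0 \in A' ++ q].
Proof.
move=> e gA' simA covP h0.
have [q [eq sq hq]] : exists q, [/\ extends w A' q, size q <= size prf * step_cost
    & {in A ++ prf, forall D, simulated d tau (A' ++ q) D}].
  have : forall k, k <= size prf -> exists q, [/\ extends w A' q, size q <= k * step_cost
      & {in A ++ take k prf, forall D, #|D| <= K /\ simulated d tau (A' ++ q) D}].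
    elim=> [_|k IH lk].
      by exists [::]; split=> //; rewrite take0 !cats0.
    have [q [eq sq hq]] := IH (ltnW lk).
    have [_ st] := e _ lk.
    have mk : nth set0 prf k \in prf by exact: mem_nth.
    have [cD cvD] := covP _ mk.
    have [q' [eq' sq' hq']] : exists q', [/\ extends w (A' ++ q) q', size q' <= step_cost
        & simulated d tau ((A' ++ q) ++ q') (nth set0 prf k)].
      case: cvD => [sat|[Y [fY dY Y0 cv]]].
        by exists [::]; split=> //; left.
      by apply: (simulated_step (extends_sdnf gA' eq) st hq cD fY).
    exists (q ++ q'); split; first exact: extends_cat.
      by rewrite size_cat mulSn addnC leq_add.
    move=> D; rewrite (take_nth set0) // -cats1 (catA A) (mem_cat D (A ++ _)) => /orP[/hq hD|].
      case: hD => ? ?; split=> //; rewrite catA; apply: sub_simulated; last by eassumption.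
      by move=> M MP; rewrite mem_cat MP.
    by rewrite mem_seq1 => /eqP ->; split=> //; rewrite catA.
  move=> /(_ _ (leqnn _)) [q [eq sq]]; rewrite take_size => hq.
  by exists q; split=> // D /hq hD; case: hD.
exists q; split=> //.
case: (hq _ h0) => [/exists_inP[T]|[Y [_ _ /(_ erefl) -> h]]]; first by rewrite inE.
have bl : branch_line tau set0 set0 set0 = set0.
  apply/setP => T; rewrite !inE; apply/negbTE; rewrite negb_or; apply/andP; split.
    by apply/negP => /imsetP[l]; rewrite inE.
  by apply/negP => /reductP[T0 []]; rewrite inE.
have : full set0 (set0 : {set literal V}).
  by split=> [|v]; rewrite ?sub0set ?inE.
move=> /h; rewrite bl => -[|[M MP]]; first by rewrite inE.
by rewrite subset0 => /eqP <-.
Qed.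

Lemma leq_cardsU (T : finType) (A B : {set T}) a b :
  #|A| <= a -> #|B| <= b -> #|A :|: B| <= a + b.
Proof. by move=> hA hB; apply: leq_trans (leq_card_setU _ _) _; exact: leq_add. Qed.

(** A set [U] collects the terms of all derived lines: a step adds to it at most one new term and
    the terms of at most two axioms. *)
Lemma refutation_terms (b : nat) (A prf : seq (dnf V)) :
  extends s A prf -> {in A, forall D, #|D| <= b} ->
  {in prf, forall D, #|D| <= size prf * (2 * b + 1)}.
Proof.
move=> e hb.
have [U [cU hU]] : exists U : dnf V, #|U| <= size prf * (2 * b + 1) /\
    {in prf, forall D, D \subset U}.
  have : forall k, k <= size prf -> exists U : dnf V, #|U| <= k * (2 * b + 1) /\
      {in take k prf, forall D, D \subset U}.
    elim=> [_|k IH lk]; first by exists set0; rewrite take0 cards0.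
    have [U [cU hU]] := IH (ltnW lk); have [_ st] := e _ lk.
    have prem D : D \in A ++ take k prf ->
        exists2 U' : dnf V, #|U'| <= b & D \subset U :|: U'.
      rewrite mem_cat => /orP[/hb cD|/hU sD]; first by exists D; rewrite ?subsetUr.
      by exists set0; rewrite ?cards0 ?setU0.
    suff [U' cU' sU'] : exists2 U' : dnf V, #|U'| <= 2 * b + 1 & nth set0 prf k \subset U :|: U'.
      exists (U :|: U'); split.
        by rewrite mulSn addnC; apply: leq_trans (leq_card_setU _ _) _; exact: leq_add.
      move=> D; rewrite (take_nth set0) // mem_rcons inE => /orP[/eqP ->//|/hU sD].
      exact: subset_trans sD (subsetUl _ _).
    case: st => [D1 D2 J1 J2|D1 D2 J|D' J|D' J1 J2].
    - move=> /prem[U1 c1 /subsetP s1] /prem[U2 c2 /subsetP s2] _.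
      exists (U1 :|: U2 :|: [set J1 :|: J2]).
        by rewrite mul2n -addnn; do !apply: leq_cardsU => //; rewrite cards1.
      apply/subsetP => T; rewrite !inE => /orP[/orP[] hT|->]; last by rewrite !orbT.
        by have := s1 T; rewrite !inE hT => /(_ isT) /orP[->|->]; rewrite ?orbT.
      by have := s2 T; rewrite !inE hT => /(_ isT) /orP[->|->]; rewrite ?orbT.
    - move=> /prem[U1 c1 /subsetP s1] /prem[U2 c2 /subsetP s2].
      exists (U1 :|: U2).
        by apply: leq_trans (leq_cardsU c1 c2) _; lia.
      apply/subsetP => T; rewrite !inE => /orP[] hT.
        by have := s1 T; rewrite !inE hT => /(_ isT) /orP[->|->]; rewrite ?orbT.
      by have := s2 T; rewrite !inE hT => /(_ isT) /orP[->|->]; rewrite ?orbT.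
    - move=> /prem[U1 c1 /subsetP s1] _; exists (U1 :|: [set J]).
        by apply: leq_trans (leq_cardsU c1 (leqnn _)) _; rewrite cards1; lia.
      apply/subsetP => T; rewrite !inE => /orP[hT|->]; last by rewrite !orbT.
      by have := s1 T; rewrite !inE hT => /(_ isT) /orP[->|->]; rewrite ?orbT.
    - move=> /prem[U1 c1 /subsetP s1]; exists (U1 :|: [set J1]).
        by apply: leq_trans (leq_cardsU c1 (leqnn _)) _; rewrite cards1; lia.
      apply/subsetP => T; rewrite !inE => /orP[hT|->]; last by rewrite !orbT.
      by have := s1 T; rewrite !inE hT => /(_ isT) /orP[->|->]; rewrite ?orbT.
  by move=> /(_ _ (leqnn _)); rewrite take_size.
by move=> D /hU sD; apply: leq_trans cU; exact: subset_leq_card.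
Qed.

End Refutation.

(** * The method of conditional expectations for independent choices *)

Section ConditionalExpectations.
Import Order.TTheory GRing.Theory Num.Theory.
Local Open Scope ring_scope.

Variables (R : realFieldType) (I Om Tm : finType).
Variables (A : I -> {set Om}) (E : I -> Tm -> {set Om}).
Hypothesis A_neq0 : forall i, A i != set0.

Definition weight (i : I) (T : Tm) : R := #|A i :&: E i T|%:R / #|A i|%:R.

Definition touches (i : I) (T : Tm) : bool := ~~ (A i \subset E i T).

Let value (S : seq I) (f : I -> Om) i T : R :=
  if i \in S then (f i \in E i T)%:R else weight i T.

(* The conditional probability that no term of [M] is satisfied, once the
   choices [f i] with [i] in [S] are revealed. *)
Let survival S f (M : {set Tm}) : R :=
  \prod_(T in M) (1 - \prod_i value S f i T).

Let update (f : I -> Om) i om := fun j => if j == i then om else f j.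

Lemma card_neq0 i : #|A i|%:R != 0 :> R.
Proof. by rewrite pnatr_eq0 -lt0n card_gt0. Qed.

Lemma weight_ge0 i T : 0 <= weight i T.
Proof. by rewrite divr_ge0. Qed.

Lemma weight_le1 i T : weight i T <= 1.
Proof.
rewrite ler_pdivrMr ?mul1r ?ler_nat; first exact: subset_leq_card (subsetIl _ _).
by rewrite ltr0n card_gt0.
Qed.

Lemma untouched_weight i T : ~~ touches i T -> weight i T = 1.
Proof. by rewrite negbK => /setIidPl e; rewrite /weight e divff ?card_neq0. Qed.

(** At most one term [T0] of [M] is touched by [i], so the choice at [i] enters a single factor, and
    affinely. An untouched term has weight 1 at [i] and is met by every choice in [A i]. *)
Lemma survival_average S f i (M : {set Tm}) :
  i \notin S ->
  {in M &, forall T T', touches i T -> touches i T' -> T = T'} ->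
  \sum_(om in A i) survival (i :: S) (update f i om) M =
  #|A i|%:R * survival S f M.
Proof.
move=> iS hM.
have other om j T : j != i -> value (i :: S) (update f i om) j T = value S f j T.
  by move=> ji; rewrite /value inE /update (negPf ji).
have split_i S' f' T : \prod_j value S' f' j T =
    value S' f' i T * \prod_(j | j != i) value S' f' j T by rewrite (bigD1 i).
have untouched om T : om \in A i -> ~~ touches i T ->
    1 - \prod_j value (i :: S) (update f i om) j T = 1 - \prod_j value S f j T.
  move=> omA nt; rewrite !split_i; congr (1 - _ * _); last first.
    by apply: eq_bigr => j ji; exact: other.
  rewrite /value inE eqxx (negPf iS) untouched_weight // /update eqxx.
  by rewrite negbK in nt; rewrite (subsetP nt).
case: (pickP [pred T | (T \in M) && touches i T]) => [T0 /= /andP[T0M tT0]|none]; last first.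
  rewrite mulr_natl -sumr_const; apply: eq_bigr => om omA.
  apply: eq_bigr => T TM; apply: untouched => //.
  by have := none T; rewrite /= TM => /negbT.
pose c := \prod_(j | j != i) value S f j T0.
pose rest := \prod_(T in M | T != T0) (1 - \prod_j value S f j T).
have -> : survival S f M = (1 - weight i T0 * c) * rest.
  by rewrite /survival (bigD1 T0) //= split_i /value (negPf iS).
transitivity (\sum_(om in A i) (1 - (om \in E i T0)%:R * c) * rest).
  apply: eq_bigr => om omA; rewrite /survival (bigD1 T0) //= split_i.
  congr ((1 - _ * _) * _).
  - by rewrite /value inE eqxx /update eqxx.
  - by apply: eq_bigr => j ji; exact: other.
  apply: eq_bigr => T /andP[TM TT0]; apply: untouched => //.
  by apply: contra TT0 => tT; apply/eqP; exact: hM.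
rewrite -mulr_suml mulrA; congr (_ * _).
rewrite sumrB sumr_const -mulr_suml mulrBr mulr1; congr (_ - _).
rewrite mulrA; congr (_ * _); rewrite /weight mulrC divfK ?card_neq0 //.
rewrite -natr_sum; congr _%:R; rewrite -sum1_card big_mkcond /= [RHS]big_mkcond /=.
apply: eq_bigr => om _; rewrite inE; case: (om \in A i) => //=.
Qed.

(** Otherwise every choice at [i] would exceed the average given by [survival_average]. *)
Lemma choice_step S f i (Ms : seq {set Tm}) :
  i \notin S ->
  (forall M, M \in Ms ->
     {in M &, forall T T', touches i T -> touches i T' -> T = T'}) ->
  exists2 om, om \in A i
    & \sum_(M <- Ms) survival (i :: S) (update f i om) M <=
      \sum_(M <- Ms) survival S f M.
Proof.
move=> iS hM.
have [/exists_inP[om omA h]|no] := boolP [exists om in A i,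
    \sum_(M <- Ms) survival (i :: S) (update f i om) M <=
    \sum_(M <- Ms) survival S f M]; first by exists om.
have : \sum_(om in A i) \sum_(M <- Ms) survival S f M <
    \sum_(om in A i) \sum_(M <- Ms) survival (i :: S) (update f i om) M.
  have /set0Pn[om0 om0A] := A_neq0 i.
  have lt om : om \in A i -> \sum_(M <- Ms) survival S f M <
      \sum_(M <- Ms) survival (i :: S) (update f i om) M.
    move=> omA; move: no; rewrite negb_exists => /forallP /(_ om).
    by rewrite omA /= -ltNge.
  rewrite (bigD1 om0) //= [X in _ < X](bigD1 om0) //= ltr_leD ?lt //.
  by apply: ler_sum => om /andP[omA _]; exact/ltW/lt.
rewrite [X in _ < X]exchange_big /= sumr_const -mulr_natl.
rewrite [X in _ < X](eq_big_seq (fun M => #|A i|%:R * survival S f M)); last first.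
  by move=> M MMs; apply: survival_average => //; exact: hM.
by rewrite -mulr_sumr ltxx.
Qed.

Lemma exists_satisfying_choice (Ms : seq {set Tm}) :
  (forall M i, M \in Ms ->
     {in M &, forall T T', touches i T -> touches i T' -> T = T'}) ->
  \sum_(M <- Ms) \prod_(T in M) (1 - \prod_i weight i T) < 1 ->
  exists f : I -> Om, (forall i, f i \in A i) /\
    {in Ms, forall M : {set Tm}, exists2 T, T \in M & forall i, f i \in E i T}.
Proof.
move=> hM lt1.
have [f [fA hf]] : exists f : I -> Om, (forall i, f i \in A i) /\
    \sum_(M <- Ms) survival (enum I) f M <= \sum_(M <- Ms) \prod_(T in M) (1 - \prod_i weight i T).
  have : uniq (enum I) by exact: enum_uniq.
  elim: (enum I) => [_|i S IH /= /andP[iS uS]].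
    have f0 i : {om | om \in A i} by have /set0Pn h := A_neq0 i; exact: sigW h.
    exists (fun i => sval (f0 i)); split; first by move=> i; case: (f0 i).
    exact: lexx.
  have [f [fA hf]] := IH uS.
  have [om omA hom] := choice_step f iS (fun M MMs => hM M i MMs).
  exists (update f i om); split; last exact: le_trans hom hf.
  by move=> j; rewrite /update; case: eqP => [->|].
exists f; split=> // M MMs.
have valE i T : value (enum I) f i T = (f i \in E i T)%:R.
  by rewrite /value mem_enum.
have [/exists_inP[T TM /forallP h]|no] :=
  boolP [exists T in M, [forall i, f i \in E i T]]; first by exists T.
(* A family without a satisfied term would alone contribute 1 to a sum of nonnegative terms that is
   below 1. *)
have one : survival (enum I) f M = 1.
  rewrite /survival big1 // => T TM.
  move: no; rewrite negb_exists => /forallP /(_ T); rewrite TM /= negb_forall.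
  by case/existsP => i iE; rewrite (bigD1 i) //= valE (negPf iE) mul0r subr0.
have ge0 M' : 0 <= survival (enum I) f M'.
  apply: prodr_ge0 => T _; rewrite subr_ge0; apply: prodr_ile1 => i _.
  by rewrite valE; case: (_ \in _); rewrite ler01 lexx.
have := le_lt_trans hf lt1.
rewrite (big_rem M) //= one -subr_gt0 opprD addrA subrr sub0r oppr_gt0.
by rewrite ltNge sumr_ge0.
Qed.

End ConditionalExpectations.

(** * Counting the choices of [s] bits of one pigeon *)

Section BitChoices.
Variables (L : nat).

(** A random [s]-subset of [u] bits contains [k] given bits with probability equal to the product of
    the [(s - i) / (u - i)] for [i < k]. The first factor [s / u] is kept, and each other one is at
    least [1 / u]. *)
Lemma bin_ratio u s k : 0 < k <= s ->
  s * 'C(u, s) <= u ^ k * 'C(u - k, s - k).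
Proof.
move=> /andP[]; elim: k => // -[_ _|k IH _ ks].
  by case: s => // s _; rewrite expn1 !subn1 /= mul_bin_diag.
have /leq_trans -> // := IH isT (ltnW ks).
rewrite [u ^ k.+2]expnSr -mulnA leq_mul2l; apply/orP; right.
have -> : s - k.+1 = (s - k.+2).+1 by lia.
apply: leq_trans (_ : (s - k.+2).+1 * 'C(u - k.+1, (s - k.+2).+1) <= _).
  by rewrite leq_pmull.
rewrite -mul_bin_diag (_ : (u - k.+1).-1 = u - k.+2); last by lia.
by rewrite leq_mul2r leq_subr orbT.
Qed.

(** Values are drawn for all [L] bits, which makes the sample space a product where positions and
    values are counted separately; [fill_in] reads the values at the chosen positions. *)
Definition bit_choice : finType := ({set 'I_L} * {ffun 'I_L -> bool})%type.

Definition choices (F : {set 'I_L}) (s : nat) : {set bit_choice} :=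
  setX [set B : {set 'I_L} | B \subset F & #|B| == s] setT.

Lemma card_choices F s : #|choices F s| = 'C(#|F|, s) * 2 ^ L.
Proof. by rewrite cardsX cards_draws cardsT card_ffun card_bool card_ord. Qed.

Lemma card_agree (K : {set 'I_L}) (b : 'I_L -> bool) :
  #|[set v : {ffun 'I_L -> bool} | [forall j in K, v j == b j]]| * 2 ^ #|K| = 2 ^ L.
Proof.
pose F j := [pred x : bool | (j \in K) ==> (x == b j)].
have -> : #|[set v : {ffun 'I_L -> bool} | [forall j in K, v j == b j]]| =
    #|family F|.
  by apply: eq_card => v; rewrite inE; apply: eq_forallb => j; rewrite inE.
rewrite card_family foldrE big_map big_enum /=.
have -> : 2 ^ #|K| = \prod_(j : 'I_L) (if j \in K then 2 else 1).
  by rewrite -big_mkcond prod_nat_const.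
have -> : 2 ^ L = \prod_(j : 'I_L) 2 by rewrite prod_nat_const card_ord.
rewrite -big_split /=.
apply: eq_bigr => j _; rewrite [#|_|](_ : _ = if j \in K then 1 else 2).
  by case: (j \in K).
case: ifP => _; first by rewrite -(card1 (b j)); apply: eq_card => x; rewrite !inE.
by rewrite -card_bool; apply: eq_card => x; rewrite !inE.
Qed.

Lemma card_supersets (F K : {set 'I_L}) s : K \subset F -> #|K| <= s ->
  'C(#|F| - #|K|, s - #|K|) <=
  #|[set B : {set 'I_L} | [&& K \subset B, B \subset F & #|B| == s]]|.
Proof.
move=> sK ks.
have <- : #|F :\: K| = #|F| - #|K| by rewrite cardsD (setIidPr sK).
rewrite -cards_draws.
rewrite -(card_in_imset (f := fun B => B :|: K)); last first.
  move=> B B'; rewrite !inE => /andP[/subsetDP[_ dB] _] /andP[/subsetDP[_ dB'] _] e.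
  by rewrite -(setDidPl dB) -(setDidPl dB') -[B :\: K]setU0 -[B' :\: K]setU0 -(setDv K) -!setDUl e.
apply: subset_leq_card; apply/subsetP => X /imsetP[B].
rewrite !inE => /andP[/subsetDP[sB dB] /eqP cB] -> {X}.
rewrite subsetUr subUset sB sK /= cardsU cB.
by rewrite disjoint_setI0 // cards0 subn0 subnK.
Qed.

(** With [k = #|K|], the positions contribute [s / u^k] by [bin_ratio], and agreement of the values
    contributes [1 / 2^k]. *)
Lemma card_satisfying_choices (F K : {set 'I_L}) (b : 'I_L -> bool) u s :
  #|F| = u -> K \subset F -> 0 < #|K| <= s ->
  s * #|choices F s| <= (2 * u) ^ #|K| *
    #|choices F s :&: [set om : bit_choice | (K \subset om.1) &&
                          [forall j in K, om.2 j == b j]]|.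
Proof.
move=> cF sK ks.
have -> : choices F s :&: [set om : bit_choice | (K \subset om.1) &&
      [forall j in K, om.2 j == b j]] =
    setX [set B : {set 'I_L} | [&& K \subset B, B \subset F & #|B| == s]]
         [set v : {ffun 'I_L -> bool} | [forall j in K, v j == b j]].
  apply/setP => -[B v]; rewrite !inE /= andbT.
  by case: (K \subset B); rewrite ?andbF //= -andbA.
rewrite card_choices cardsX cF -(card_agree K b) expnMn.
have := bin_ratio u ks; have := card_supersets sK (proj2 (andP ks)); rewrite cF.
set x := 'C(_ - _, _); set y := #|[set B | _]|; set z := #|[set v | _]|.
move=> xy h.
have -> : s * ('C(u, s) * (z * 2 ^ #|K|)) = s * 'C(u, s) * (z * 2 ^ #|K|) by ring.
have -> : 2 ^ #|K| * u ^ #|K| * (y * z) = u ^ #|K| * y * (z * 2 ^ #|K|) by ring.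
rewrite leq_mul2r; apply/orP; right; apply: leq_trans h _.
by rewrite leq_mul2l xy orbT.
Qed.

End BitChoices.

(** * The random restriction of the binary pigeonhole principle *)

Section RandomRestriction.
Import Order.TTheory GRing.Theory Num.Theory.
Variables (m n s t : nat) (rho : restriction (php_var m n)).
Hypotheses (rho_t : bit_restriction t rho) (s_gt0 : 0 < s) (st_lt : s + t < lg n).

Local Notation V := (php_var m n).
Local Notation L := (lg n).
Local Notation u := (lg n - t).
Implicit Types (D : dnf V) (T : term V) (M : {set term V}) (i : 'I_m).

Definition free_bits i : {set 'I_L} := [set j | rho (i, j) == None].

Definition event i T : {set bit_choice L} :=
  [set om : bit_choice L | [forall l in T,
     (l.1.1 == i) ==> (l.1.2 \in om.1) && (om.2 l.1.2 == l.2)]].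

Definition pigeons T : {set 'I_m} := [set l.1.1 | l : literal V in T].

Definition spread M : bool :=
  [forall T in M, forall T' in M, (T != T') ==> [disjoint pigeons T & pigeons T']].

(** Computed from [rho], so that the disjoint families are fixed before the random bits are
    chosen. *)
Definition live_terms D : {set term V} :=
  [set T :\: true_lits rho
     | T : term V in D & consistent T && [disjoint T & false_lits rho]].

Lemma card_free_bits i : #|free_bits i| = u.
Proof.
have := cardsC (free_bits i); rewrite card_ord.
have -> : ~: free_bits i = [set j : 'I_(lg n) | rho (i, j) != None].
  by apply/setP => j; rewrite !inE.
by rewrite rho_t => e; rewrite -[LHS](addnK t) e.
Qed.

Local Notation pick_bits := (fun i => choices (free_bits i) s).

Lemma pick_bits_neq0 i : pick_bits i != set0.
Proof.
by rewrite -card_gt0 card_choices card_free_bits muln_gt0 bin_gt0 expn_gt0 andbT; lia.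
Qed.

Lemma touches_pigeons i T : touches pick_bits event i T -> i \in pigeons T.
Proof.
apply: contraNT => ni; apply/subsetP => om _; rewrite inE.
apply/forall_inP => l lT; apply/implyP => /eqP li.
by case/negP: ni; apply/imsetP; exists l.
Qed.

Lemma live_termsP D T' : T' \in live_terms D ->
  [/\ consistent T', {in T', forall l, rho l.1 = None} &
    exists T, [/\ T \in D, consistent T & T \subset T' :|: true_lits rho]].
Proof.
case/imsetP => T; rewrite inE => /and3P[TD cT /disjoint_inP dT] ->; split.
- exact: sub_consistent (subsetDl _ _) cT.
- move=> [v b]; rewrite inE => /andP[nt /[dup] lT /dT]; move: nt; rewrite !inE /=.
  by case: (rho v) => [[]|] //; case: b {lT}.
- by exists T; split=> //; apply/subsetP => l lT; rewrite !inE lT andbT orNb.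
Qed.

Lemma maximal_spread (C : {set term V}) : set0 \notin C ->
  {M : {set term V} | [/\ M \subset C, spread M &
    {in C, forall T, exists2 T', T' \in M & ~~ [disjoint pigeons T & pigeons T']}]}.
Proof.
move=> C0; pose P (M : {set term V}) := (M \subset C) && spread M.
have P0 : P set0 by rewrite /P sub0set; apply/forall_inP => T; rewrite inE.
have [M /maxsetP[/andP[sM pM] maxM] _] := maxset_exists P0.
exists M; split=> // T TC.
have [/exists_inP[T' T'M h]|no] :=
  boolP [exists T' in M, ~~ [disjoint pigeons T & pigeons T']]; first by exists T'.
have dis T' : T' \in M -> [disjoint pigeons T & pigeons T'].
  move=> T'M; move: no; rewrite negb_exists => /forallP /(_ T').
  by rewrite T'M /= negbK.
(* If [T] met no member of [M], maximality would put [T] into [M]; then [T] would be disjoint from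
   itself, hence empty. *)
have TM : T \in M.
  rewrite -(maxM (T |: M)) ?subsetUr ?setU11 //.
  rewrite /P subUset sub1set TC sM /=; apply/forall_inP => T1 /setU1P h1.
  apply/forall_inP => T2 /setU1P h2; apply/implyP => ne.
  case: h1 h2 ne => [->|T1M] [->|T2M]; rewrite ?eqxx // => ne.
  - exact: dis.
  - by rewrite disjoint_sym; exact: dis.
  - by move/forall_inP: pM => /(_ _ T1M) /forall_inP /(_ _ T2M); rewrite ne.
have := dis T TM; rewrite -setI_eq0 setIid => /eqP T0.
case/negP: C0; suff <- : T = set0 by [].
apply/setP => l; rewrite inE; apply/negbTE/negP => lT.
by have := imset_f (fun l : literal V => l.1.1) lT; rewrite -/(pigeons T) T0 inE.
Qed.

Section Weights.
Variable R : realFieldType.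
Local Open Scope ring_scope.

Let occ i T := [set l in T | l.1.1 == i].

Lemma sum_occ T : (\sum_i #|occ i T|)%N = #|T|.
Proof.
rewrite -sum1_card (partition_big (fun l : literal V => l.1.1) predT) //=.
by apply: eq_bigr => i _; rewrite sum1dep_card cardsE.
Qed.

Lemma weight_occ i T : consistent T -> {in T, forall l, rho l.1 = None} ->
  (0 < #|occ i T| <= s)%N ->
  s%:R <= (2 * u)%:R ^+ #|occ i T| * weight R pick_bits event i T.
Proof.
move=> /consistentP cT fT hk.
pose K := [set l.1.2 | l in occ i T].
have cK : #|K| = #|occ i T|.
  apply: card_in_imset => -[[i1 j1] b1] [[i2 j2] b2].
  rewrite !inE /= => /andP[T1 /eqP e1] /andP[T2 /eqP e2] e; subst i1 i2 j2.
  by have := cT _ T1; rewrite /neg_lit /=; case: b1 b2 T1 T2 => [] [] // T1 T2; rewrite T2.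
have sK : K \subset free_bits i.
  apply/subsetP => j /imsetP[[[i' j'] b]]; rewrite inE /= => /andP[lT /eqP e] ->.
  by subst i'; rewrite inE; have /= -> := fT _ lT.
pose b (j : 'I_L) := (((i, j) : V), true) \in T.
have eE : event i T = [set om : bit_choice L | (K \subset om.1) &&
    [forall j in K, om.2 j == b j]].
  apply/setP => om; rewrite !inE; apply/forall_inP/andP => [h|[/subsetP h1 /forall_inP h2]].
    split; first apply/subsetP.
      move=> j /imsetP[l]; rewrite inE => /andP[lT li] ->.
      by have := h l lT; rewrite li => /andP[].
    apply/forall_inP => j /imsetP[[[i' j'] b']]; rewrite inE /= => /andP[lT /eqP e] ->.
    subst i'; have := h _ lT; rewrite eqxx /= => /andP[_ /eqP ->].
    rewrite /b; case: b' lT => lT; first by rewrite lT.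
    by rewrite eq_sym eqbF_neg; exact: (cT _ lT).
  move=> [[i' j'] b'] lT; apply/implyP => /= /eqP e; subst i'.
  have jK : j' \in K by apply/imsetP; exists ((i, j'), b') => //; rewrite inE lT /=.
  rewrite (h1 _ jK) /=; move/eqP: (h2 _ jK) => ->; rewrite /b.
  case: b' lT => lT; first by rewrite lT.
  by rewrite eqbF_neg; exact: (cT _ lT).
rewrite /weight mulrA ler_pdivlMr; last by rewrite ltr0n card_gt0 pick_bits_neq0.
rewrite -natrX -!natrM ler_nat eE -cK.
by apply: card_satisfying_choices => //; [exact: card_free_bits|rewrite cK].
Qed.

(** The factor [s] is kept for one pigeon of [T] and replaced by 1 for the others; the exponents of
    [2 * u] add up to [#|T|]. *)
Lemma prod_weight T : consistent T -> {in T, forall l, rho l.1 = None} ->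
  T != set0 -> (#|T| <= s)%N ->
  s%:R <= (2 * u)%:R ^+ s * \prod_i weight R pick_bits event i T.
Proof.
move=> cT fT T0 Ts.
have u_ge1 : 1 <= (2 * u)%:R :> R by rewrite ler1n; lia.
have occ_le i : (#|occ i T| <= s)%N.
  apply: leq_trans Ts; apply: subset_leq_card; apply/subsetP => l.
  by rewrite inE => /andP[].
have w0 : 0 <= \prod_i weight R pick_bits event i T.
  by apply: prodr_ge0 => i _; exact: weight_ge0.
apply: le_trans (_ : (2 * u)%:R ^+ #|T| * \prod_i weight R pick_bits event i T <= _); last first.
  by apply: ler_wpM2r => //; rewrite ler_weXn2l.
rewrite -sum_occ -prodrXr -big_split /=.
have /set0Pn[l0 l0T] := T0.
rewrite (bigD1 l0.1.1) //= -[s%:R]mulr1; apply: ler_pM => //.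
  apply: weight_occ => //; rewrite occ_le andbT card_gt0; apply/set0Pn; exists l0.
  by rewrite inE l0T eqxx.
apply: le_trans (_ : \prod_(i : 'I_m | i != l0.1.1) 1 <= _); first by rewrite big1_eq.
apply: ler_prod => i _; rewrite ler01 /=.
have [k0|kp] := posnP #|occ i T|; last first.
  by apply: le_trans (weight_occ cT fT _); rewrite ?ler1n // kp occ_le.
rewrite k0 expr0 mul1r untouched_weight //; first exact: pick_bits_neq0.
apply/negP => /touches_pigeons /imsetP[l lT li].
by have := card0_eq k0 l; rewrite !inE lT li eqxx.
Qed.

End Weights.

Definition fill_in (f : 'I_m -> bit_choice L) : restriction V := fun v =>
  if rho v is Some b then Some b
  else if v.2 \in (f v.1).1 then Some ((f v.1).2 v.2) else None.

Lemma fill_in_bits f : (forall i, f i \in pick_bits i) ->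
  bit_restriction (s + t) (fill_in f).
Proof.
move=> fA i.
have := fA i; rewrite !inE => /andP[/andP[/subsetP sB /eqP cB] _].
have -> : [set j : 'I_L | fill_in f (i, j) != None] =
    (f i).1 :|: [set j | rho (i, j) != None].
  apply/setP => j; rewrite !inE /fill_in /=; case: (rho (i, j)) => [b|] /=.
    by rewrite orbT.
  by rewrite orbF; case: (j \in _).
rewrite cardsU cB rho_t disjoint_setI0 ?cards0 ?subn0 //.
apply/pred0P => j /=; rewrite !inE; apply/negbTE; rewrite negb_and negbK.
by case: (boolP (j \in (f i).1)) => // /sB; rewrite inE => ->.
Qed.

Lemma card_pigeon_vars (Pg : {set 'I_m}) (Y : {set V}) :
  {in Y, forall v, (v.1 \in Pg) /\ rho v = None} -> #|Y| <= #|Pg| * u.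
Proof.
move=> hY.
rewrite -sum1_card (partition_big (fun v : V => v.1) (mem Pg)) /=; last first.
  by move=> v /hY[].
rewrite -sum_nat_const; apply: leq_sum => i _.
rewrite sum1dep_card -(card_free_bits i).
rewrite -(card_in_imset (f := fun v : V => v.2)); last first.
  by move=> [i1 j1] [i2 j2]; rewrite !inE /= => /andP[_ /eqP ->] /andP[_ /eqP ->] ->.
apply: subset_leq_card; apply/subsetP => j /imsetP[[i' j']].
rewrite inE /= => /andP[/hY[_ e] /eqP e'] ->; subst i'.
by rewrite inE e.
Qed.

Lemma killing_restriction (R : realFieldType) (r : nat) (prf : seq (dnf V)) :
  {in prf, forall D, is_sdnf s D} ->
  ((size prf)%:R * (1 - s%:R / (2 * u)%:R ^+ s) ^+ r < 1 :> R)%R ->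
  exists tau : restriction V,
    [/\ bit_restriction (s + t) tau,
        forall v b, rho v = Some b -> tau v = Some b &
        {in prf, forall D, satisfied tau D \/
           exists Y, [/\ free tau Y, #|Y| <= r.-1 * s * u, D = set0 -> Y = set0
                       & covers tau s.-1 Y D]}].
Proof.
move=> wprf hr.
have fam D : {M : {set term V} | [/\ M \subset live_terms D :\ set0, spread M &
    {in live_terms D :\ set0, forall T, exists2 T', T' \in M &
      ~~ [disjoint pigeons T & pigeons T']}]}.
  by apply: maximal_spread; rewrite !inE eqxx.
pose F D := sval (fam D).
have subF D : F D \subset live_terms D :\ set0 by rewrite /F; case: (fam D) => M [].
have spF D : spread (F D) by rewrite /F; case: (fam D) => M [].
have maxF D : {in live_terms D :\ set0, forall T, exists2 T', T' \in F D &
      ~~ [disjoint pigeons T & pigeons T']} by rewrite /F; case: (fam D) => M [].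
pose Ms := [seq F D | D <- prf & r <= #|F D|].
have liveF D T : D \in prf -> T \in F D ->
    [/\ consistent T, {in T, forall l, rho l.1 = None}, T != set0 & #|T| <= s].
  move=> Dprf /(subsetP (subF D)) /setD1P[T0 /[dup] TD /live_termsP[cT fT _]]; split=> //.
  case/imsetP: TD => T1; rewrite inE => /andP[T1D _] ->.
  apply: leq_trans (subset_leq_card (subsetDl _ _)) _.
  by have /sdnfP := wprf _ Dprf; apply.
have one_touch M i : M \in Ms ->
    {in M &, forall T T', touches pick_bits event i T -> touches pick_bits event i T' -> T = T'}.
  case/mapP => D _ -> T T' TM T'M /touches_pigeons iT /touches_pigeons iT'.
  apply/eqP/negPn/negP => ne.
  move/forall_inP: (spF D) => /(_ _ TM) /forall_inP /(_ _ T'M); rewrite ne /=.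
  by move/pred0P => /(_ i); rewrite /= iT iT'.
have lt1 : (\sum_(M <- Ms) \prod_(T in M) (1 - \prod_i weight R pick_bits event i T) < 1)%R.
  apply: le_lt_trans hr.
  set q : R := (1 - _)%R.
  have u_gt0 : (0 < (2 * u)%:R ^+ s :> R)%R by rewrite exprn_gt0 // ltr0n; lia.
  have q_ge0 : (0 <= q)%R.
    rewrite subr_ge0 ler_pdivrMr // mul1r -natrX ler_nat; apply: ltnW.
    by apply: ltn_expl; lia.
  have q_le1 : (q <= 1)%R by rewrite lerBlDr lerDl divr_ge0 // ltW.
  have hw D T : D \in prf -> T \in F D ->
      (0 <= 1 - \prod_i weight R pick_bits event i T <= q)%R.
    move=> Dprf TM; have [cT fT T0 Ts] := liveF _ _ Dprf TM.
    rewrite subr_ge0 prodr_ile1 /=; last first.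
      by move=> i _; rewrite weight_ge0 weight_le1 //; exact: pick_bits_neq0.
    by rewrite lerB // ler_pdivrMr // mulrC prod_weight.
  have hM M : M \in Ms -> (\prod_(T in M) (1 - \prod_i weight R pick_bits event i T) <= q ^+ r)%R.
    case/mapP => D; rewrite mem_filter => /andP[rF Dprf] ->.
    apply: le_trans (_ : (q ^+ #|F D| <= _)%R).
      by rewrite -prodr_const; apply: ler_prod => T TM; exact: (hw D).
    exact: ler_wiXn2l.
  apply: le_trans (_ : (\sum_(M <- Ms) q ^+ r <= _)%R).
    by rewrite !big_seq; apply: ler_sum => M; exact: hM.
  rewrite big_const_seq count_predT iter_addr_0 -[(_ *+ _)%R]mulr_natl.
  apply: ler_wpM2r; first exact: exprn_ge0.
  by rewrite ler_nat size_map size_filter count_size.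
have [f [fA hf]] := exists_satisfying_choice pick_bits_neq0 one_touch lt1.
pose tau := fill_in f.
have ext v b : rho v = Some b -> tau v = Some b by rewrite /tau /fill_in => ->.
have ext_true : true_lits rho \subset true_lits tau.
  by apply/subsetP => l; rewrite !inE => /eqP /ext ->.
exists tau; split=> //; first exact: fill_in_bits.
move=> D Dprf.
have [sat|nsat] := boolP (satisfied tau D); [by left|right].
have smallF : #|F D| <= r.-1.
  suff : #|F D| < r by lia.
  rewrite ltnNge; apply: contra nsat => rF.
  have [|T TM hT] := hf (F D); first by apply/mapP; exists D => //; rewrite mem_filter rF.
  have /setD1P[_ /live_termsP[cT fT [T1 [T1D cT1 sT1]]]] := subsetP (subF D) _ TM.
  apply/exists_inP; exists T1 => //; rewrite cT1; apply/subsetP => l /(subsetP sT1).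
  case/setUP => [lT|/(subsetP ext_true)//]; rewrite inE /tau /fill_in (fT _ lT).
  have := hT l.1.1; rewrite inE => /forall_inP /(_ _ lT); rewrite eqxx /=.
  by move=> /andP[-> /eqP ->].
pose Pg := \bigcup_(T in F D) pigeons T.
pose Y := [set v : V | (v.1 \in Pg) && (tau v == None)].
have cPg : #|Pg| <= r.-1 * s.
  apply: leq_trans (_ : \sum_(T in F D) #|pigeons T| <= _).
    rewrite /Pg; elim/big_ind2: _ => [|A1 k1 A2 k2 h1 h2|//]; first by rewrite cards0.
    by apply: leq_trans (leq_card_setU _ _) _; exact: leq_add.
  apply: leq_trans (_ : \sum_(T in F D) s <= _).
    apply: leq_sum => T TM; apply: leq_trans (leq_imset_card _ _) _.
    by have [] := liveF _ _ Dprf TM.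
  by rewrite sum_nat_const leq_mul2r smallF orbT.
exists Y; split.
- by move=> v; rewrite inE => /andP[_ /eqP].
- apply: leq_trans (_ : #|Pg| * u <= _); last by rewrite leq_mul2r cPg orbT.
  apply: card_pigeon_vars => v; rewrite inE => /andP[-> /eqP e]; split=> //.
  by case er : (rho v) => [b|//]; rewrite (ext _ _ er) in e.
- move=> D0; apply/setP => v; rewrite !inE; apply/negbTE; rewrite negb_and; apply/orP; left.
  apply/bigcupP => -[T TM _]; have := subsetP (subF D) _ TM; rewrite inE => /andP[_].
  by case/imsetP => T0; rewrite D0 !inE.
move=> T TD cT /disjoint_inP dT.
have sT : #|T| <= s by have /sdnfP := wprf _ Dprf; apply.
have T'live : T :\: true_lits rho \in live_terms D.
  apply/imsetP; exists T => //; rewrite inE TD cT /=; apply/disjoint_inP => l /dT.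
  by rewrite !inE; apply: contra => /eqP /ext ->.
(* If [rho] made all of [T] true, [D] would be satisfied. So the live part of [T] meets a pigeon of
   the family, and its literal there is true or over [Y], which brings the width below [s]. *)
have T'0 : T :\: true_lits rho != set0.
  apply: contra nsat; rewrite setD_eq0 => sTt; apply/exists_inP; exists T => //.
  by rewrite cT (subset_trans sTt).
have [|T0 T0M /pred0Pn[i /= /andP[iT iT0]]] := maxF D (T :\: true_lits rho).
  by rewrite in_setD1 T'0.
case/imsetP: iT => l; rewrite inE => /andP[_ lT] il.
have hl : l \in true_lits tau :|: lits Y.
  have := dT _ lT; rewrite !inE; case e : (tau l.1) => [b|] /=.
    by case: l e {lT il} => v [] /=; case: b.
  by move=> _; rewrite andbT; apply/bigcupP; exists T0; rewrite -?il.
suff : #|T :\: (true_lits tau :|: lits Y)| < s by case: (s) s_gt0.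
apply: leq_trans sT; apply: proper_card; apply/properP; split; first exact: subsetDl.
by exists l => //; rewrite inE hl.
Qed.

End RandomRestriction.

(** * Restricted axioms, and the exclusion of one-step refutations *)

Lemma card_dnf_of_clause (V : finType) (C : clause V) : #|dnf_of_clause C| = #|C|.
Proof. by rewrite card_imset //; exact: set1_inj. Qed.

Lemma axiom_lines_sdnf (V : finType) (F : cnf V) w :
  0 < w -> all (is_sdnf w) (axiom_lines F).
Proof.
move=> w0; apply/allP => D /mapP[C _ ->]; apply/sdnfP => T /imsetP[l _ ->].
by rewrite cards1.
Qed.

(** An axiom not satisfied by [tau] needs no branching: restricting the original clause by [tau]
    drops the same literals as the reduct does. *)
Lemma axiom_simulated (V : finType) (F : cnf V) (rho tau : restriction V) d D :
  (forall v b, rho v = Some b -> tau v = Some b) ->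
  D \in axiom_lines (restrict_cnf rho F) ->
  simulated d tau (axiom_lines (restrict_cnf tau F)) D.
Proof.
move=> ext /mapP[C']; rewrite mem_enum => /imsetP[C]; rewrite inE => /andP[CF nsat] -> -> {C'}.
set C' := [set l in C | _].
have [/exists_inP[l lC' lt]|no] := boolP [exists l in C', tau l.1 == Some l.2].
  left; apply/exists_inP; exists [set l]; first by apply/imsetP; exists l.
  by rewrite consistent1 sub1set inE.
have nlt l : l \in C' -> tau l.1 != Some l.2.
  by move=> lC; move: no; rewrite negb_exists => /forallP /(_ l); rewrite lC.
have nC l : l \in C -> tau l.1 != Some l.2.
  move=> lC; have [lC'|] := boolP (l \in C'); first exact: nlt.
  rewrite inE lC /= negbK => /eqP /ext ->.
  by apply/eqP => -[]; case: (l.2).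
right; exists set0; split; rewrite ?cards0 //.
- by move=> v; rewrite inE.
move=> Q _; right.
exists (dnf_of_clause [set l in C | tau l.1 != Some (~~ l.2)]).
  apply: map_f; rewrite mem_enum; apply/imsetP; exists C => //.
  by rewrite inE CF; apply/forall_inP.
apply/subsetP => T /imsetP[l]; rewrite inE => /andP[lC ltau] -> {T}.
have [lQ|lQ] := boolP (l \in Q).
  by rewrite inE; apply/orP; left; apply/imsetP; exists l.
rewrite inE; apply/orP; right; apply/reductP; exists [set l]; split.
- apply/imsetP; exists l => //; rewrite inE lC /=.
  by apply: contra ltau => /eqP /ext ->.
- exact: consistent1.
- by apply/disjoint_inP => l' /set1P ->; rewrite !inE negb_or ltau.
apply/setP => l'; rewrite !inE; case: eqVneq => [->|]; last by rewrite andbF.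
by rewrite (negPf (nC _ lC)).
Qed.

(** A clause not satisfied by [rho] keeps exactly its unset literals, [lg n - t] for each of its two
    pigeons. The lower bound serves to exclude one-step refutations, the upper one to count
    terms. *)
Lemma card_axiom_line (m n t : nat) (rho : restriction (php_var m n)) D :
  bit_restriction t rho ->
  D \in axiom_lines (restrict_cnf rho (BinPHP m n)) ->
  lg n - t <= #|D| <= 2 * (lg n - t).
Proof.
move=> rt /mapP[C']; rewrite mem_enum => /imsetP[C].
rewrite !inE => /andP[/existsP[i /existsP[i' /existsP[a /andP[_ /eqP eC]]]]].
move=> /forall_inP nsat -> -> {C'}; rewrite card_dnf_of_clause.
pose side k := [set (((k, j) : php_var m n), ~~ hole_bit a j) | j in free_bits rho k].
have cside k : #|side k| = lg n - t.
  by rewrite card_imset ?(card_free_bits rt) // => j j' [].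
apply/andP; split.
  rewrite -(cside i); apply: subset_leq_card; apply/subsetP => l /imsetP[j].
  rewrite inE => /eqP jf ->; rewrite inE eC inE /= jf andbT; apply/orP; left.
  by apply/imsetP; exists j.
rewrite mul2n -addnn -{1}(cside i) -(cside i').
apply: leq_trans (leq_card_setU _ _); apply: subset_leq_card.
apply/subsetP => l; rewrite inE => /andP[lC nf].
have fl : rho l.1 = None.
  move: (nsat _ lC) nf; case: (rho l.1) => [b|//].
  by case: b; case: (l.2).
move: lC; rewrite eC => /setUP[] /imsetP[j _ el]; apply/setUP; [left|right];
  by apply/imsetP; exists j => //; rewrite inE -fl el.
Qed.

(** Only a cut can yield the empty line, and its second premise is then a single term, whereas axiom
    lines have at least two. That [N] exceeds 1 later forces [X] to be large. *)
Lemma short_refutation (V : finType) s (F : cnf V) prf :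
  {in axiom_lines F, forall D : dnf V, 1 < #|D|} -> res_refutation s F prf ->
  1 < size prf.
Proof.
move=> hA [hd h0].
have n0 : set0 \notin axiom_lines F by apply/negP => /hA; rewrite cards0.
move: h0; rewrite mem_cat (negPf n0) /=.
case: prf hd => [|D [|//]] hd //; rewrite mem_seq1 => /eqP eD.
have [_] := hd 0 isT; rewrite /= cats0 -eD.
have ne (A : dnf V) (T : term V) : A :|: [set T] <> set0.
  by move/setP/(_ T); rewrite !inE eqxx orbT.
move E : (set0 : dnf V) => D0 st; case: st E => [D1 D2 J1 J2 _ _ _|D1 D2 J _|D' J _ _|D' J1 J2 _].
- by move/esym/ne.
- move=> m2 /esym /eqP; rewrite setU_eq0 => /andP[_ /eqP e2].
  by have := hA _ m2; rewrite e2 set0U cards1.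
- by move/esym/ne.
- by move/esym/ne.
Qed.

Lemma terms_overhead N u :
  1 < N -> 2 < u -> 5 * (N * (2 * (2 * u) + 1)) + 6 <= N * (24 * u).
Proof.
move=> N1 u2; have : N * 3 <= N * u by rewrite leq_mul2l u2 orbT.
by lia.
Qed.

(** * Numerical estimates: choice of the threshold and size of the translation *)

Section Estimates.
Import Order.TTheory GRing.Theory Num.Theory.
Local Open Scope ring_scope.
Variables (R : realType) (N u s : nat) (X : R).
Hypotheses (s_gt1 : (1 < s)%N) (su : (s < u)%N).
(** For [X = target_exponent], the quotient [X / c] is the exponent of [size_bound R n s t]; see
    [size_bound_target]. *)
Let c : R := (4 * 2 ^ s * s * u ^ s.+1)%N%:R.
Lemma cost_const_gt0 : 0 < c.
Proof. by rewrite ltr0n !muln_gt0 !expn_gt0 /=; lia. Qed.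

(** [r - 1] is the integer part of [X / (4 s^2 u)]. The first bound makes bottlenecks unlikely to
    survive; the second limits the number of branching variables and holds because
    [8 s u / (4 s^2 u) = 2 / s <= 1]. *)
Lemma bottleneck_threshold : 0 <= X ->
  exists2 r, X / (4 * s ^ 2 * u)%:R <= r%:R & (8 * (r.-1 * s * u))%:R <= X.
Proof.
move=> X0; pose z := X / (4 * s ^ 2 * u)%:R.
have k_gt0 : 0 < (4 * s ^ 2 * u)%:R :> R by rewrite ltr0n !muln_gt0 ?expn_gt0; lia.
have z0 : 0 <= z by rewrite divr_ge0.
have /andP[h1 h2] := Num.Theory.truncn_itv z0.
exists (Num.truncn z).+1; first exact: ltW.
rewrite ler_pdivlMr // -natrM in h1; apply: le_trans h1; rewrite ler_nat /=.
set k := Num.truncn z; have -> : (8 * (k * s * u) = k * s * u * 8)%N by ring.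
have -> : (k * (4 * s ^ 2 * u) = k * s * u * (4 * s))%N by ring.
by rewrite leq_mul2l; apply/orP; right; lia.
Qed.

Hypothesis N_lt : N%:R < expR (X / c).

(** [(1 - p)^r <= exp (- p r)], and [p] times the lower bound on [r] is exactly [X / c], which is
    where [c] comes from. *)
Lemma bottleneck_survival r :
  X / (4 * s ^ 2 * u)%:R <= r%:R ->
  N%:R * (1 - s%:R / (2 * u)%:R ^+ s) ^+ r < 1 :> R.
Proof.
move=> hr; set p : R := s%:R / _.
have u_gt0 : (0 < (2 * u)%:R ^+ s :> R) by rewrite exprn_gt0 // ltr0n; lia.
have p_ge0 : 0 <= p by rewrite divr_ge0 // ltW.
have p_le1 : p <= 1.
  rewrite ler_pdivrMr // mul1r -natrX ler_nat; apply: ltnW.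
  by apply: ltn_expl; lia.
have le_exp : (1 - p) ^+ r <= expR (- (p * r%:R)).
  rewrite -(mulNr p) expRM_natr.
  apply: lerXn2r; rewrite ?nnegrE ?subr_ge0 ?expR_ge0 //.
  exact: expR_ge1Dx.
apply: le_lt_trans (ler_wpM2l _ le_exp) _ => //.
rewrite expRN ltr_pdivrMr ?expR_gt0 // mul1r; apply: lt_le_trans N_lt _.
rewrite ler_expR; apply: le_trans (ler_wpM2l p_ge0 hr).
have [s0 u0] : s%:R != 0 :> R /\ u%:R != 0 :> R by rewrite !pnatr_eq0; lia.
rewrite le_eqVlt; apply/orP; left; apply/eqP; rewrite /p /c !natrM !natrX !exprMn [u%:R ^+ s.+1]exprS.
by field; rewrite u0 s0 !expf_neq0 // pnatr_eq0.
Qed.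

(** The exponent is split as [X = X/16 + 3X/4 + 3X/16] among the factors [N^2], [4^(3 d)] and
    [24 u]. *)
Lemma refutation_size_bound d :
  (1 < N)%N -> (8 * d)%:R <= X ->
  (N * step_cost d (N * (2 * (2 * u) + 1)))%:R < expR X.
Proof.
move=> N1 hd.
have c_gt0 := cost_const_gt0.
have hc : (16 * u ^ 3 * 2 <= 4 * 2 ^ s * s * u ^ s.+1)%N.
  have h1 : (u ^ 3 <= u ^ s.+1)%N by rewrite leq_exp2l; lia.
  have h2 : (2 ^ 2 <= 2 ^ s)%N by rewrite leq_exp2l.
  apply: leq_trans (_ : (4 * 4 * 2 * u ^ 3 <= _)%N); first by lia.
  by rewrite !leq_mul.
have u3 : (3 ^ 3 <= u ^ 3)%N by rewrite leq_exp2r //; lia.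
(* From [expR (1/2) <= 2 <= N < expR (X / c)] follows [c / 2 <= X]: the assumed refutation itself
   excludes small [X]. *)
have X_ge : 16 * (u ^ 3)%:R <= X.
  have half : 2^-1 <= X / c.
    have e2 : expR (2^-1 : R) <= 2.
      rewrite -[X in X <= _]invrK -expRN invf_ple ?posrE ?expR_gt0 //.
      by apply: le_trans (expR_ge1Dx _); lra.
    rewrite -ler_expR; apply: le_trans e2 _; apply: ltW; apply: le_lt_trans N_lt.
    by rewrite ler_nat.
  have : c / 2 <= X by rewrite -[X in _ <= X](divfK (lt0r_neq0 c_gt0)) mulrC ler_wpM2r // ltW.
  apply: le_trans; rewrite /c ler_pdivlMr // -!natrM ler_nat; exact: hc.
have u3' : 27 <= (u ^ 3)%:R :> R by rewrite ler_nat.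
have X_gt0 : 0 < X by lra.
have hN : (N ^ 2)%:R <= expR (X / 16).
  rewrite natrX; apply: le_trans (_ : expR (X / c) ^+ 2 <= _).
    by apply: lerXn2r; rewrite ?nnegrE ?expR_ge0 ?ler0n // ltW.
  rewrite -expRM_natl ler_expR mulrA ler_pdivrMr //.
  suff : 32 <= c by move=> ?; nra.
  rewrite /c ler_nat; apply: leq_trans hc; lia.
have h4 : (4 ^ (3 * d))%:R <= expR (3 * X / 4).
  have -> : (4 ^ (3 * d) = 2 ^ (6 * d))%N.
    by rewrite -[4%N]/(2 ^ 2)%N -expnM; congr (2 ^ _)%N; lia.
  rewrite natrX; apply: le_trans (_ : expR 1 ^+ (6 * d) <= _).
    by rewrite lerXn2r ?nnegrE ?expR_ge0 //; apply: le_trans (expR_ge1Dx _); lra.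
  rewrite -expRM_natl ler_expR; move: hd; rewrite !natrM; lra.
have hu : (24 * u)%:R < expR (3 * X / 16).
  apply: lt_le_trans (expR_ge1Dx _).
  suff : (24 * u)%:R <= 3 * (u ^ 3)%:R :> R by lra.
  rewrite -natrM ler_nat (_ : 24 * u = 3 * (8 * u))%N; last by rewrite mulnA.
  rewrite leq_mul2l expnSr leq_mul2r -mulnn; apply/orP; right; apply/orP; right.
  by apply: (@leq_trans (3 * 3)) => //; apply: leq_mul; exact: leq_ltn_trans su.
apply: le_lt_trans (_ : (N ^ 2)%:R * ((4 ^ (3 * d))%:R * (24 * u)%:R) < _).
  rewrite -!natrM ler_nat /step_cost.
  have -> : (4 ^ (3 * d) = 4 ^ d * 4 ^ (2 * d))%N by rewrite -expnD; congr (4 ^ _)%N; lia.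
  set K := (N * (2 * (2 * u) + 1))%N; set a := (4 ^ d)%N; set b := (4 ^ (2 * d))%N.
  have -> : (N * (a * (b * (5 * K + 6))) = N * a * b * (5 * K + 6))%N by ring.
  have -> : (N ^ 2 * (a * b * (24 * u)) = N * a * b * (N * (24 * u)))%N by ring.
  rewrite leq_mul2l; apply/orP; right; apply: terms_overhead => //.
  exact: leq_ltn_trans su.
have -> : X = X / 16 + (3 * X / 4 + 3 * X / 16) by field.
rewrite expRD expRD.
apply: le_lt_trans (_ : expR (X / 16) * (expR (3 * X / 4) * (24 * u)%:R) < _).
  by rewrite ler_pM ?mulr_ge0 // ler_wpM2r.
by rewrite ltr_pM2l ?expR_gt0 // ltr_pM2l ?expR_gt0.
Qed.

End Estimates.

(** * Comparison of the exponents for [s - 1] and [s] *)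

Section SizeBounds.
Import Order.TTheory GRing.Theory Num.Theory.
Local Open Scope ring_scope.
Variables (R : realType) (n s t : nat).
Hypotheses (s_gt1 : (1 < s)%N) (st_lt : (s + t < lg n)%N).
Local Notation u := (lg n - t)%N.

(** The exponent for [(s - 1, s + t)] with [lg n - (s + t)] replaced by the larger [lg n - t]. This
    only lowers it and makes it comparable with the exponent for [(s, t)], which has the same base
    [u]. *)
Definition target_exponent : R :=
  n%:R / (4 ^ (xi (s - 1) + 1) * (s - 1)`! * 2 ^ (s + t) * u ^ xi (s - 1))%N%:R.

Lemma target_exponent_ge0 : 0 <= target_exponent.
Proof. by rewrite divr_ge0. Qed.

(** The recursion of [xi] supplies [4^(s+1)] and [u^(s+1)], the factorial supplies [s], and passing
    from [2^(s+t)] to [2^t] removes [2^s]. *)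
Lemma size_bound_target :
  size_bound R n s t =
  expR (target_exponent / (4 * 2 ^ s * s * u ^ s.+1)%N%:R).
Proof.
rewrite /size_bound /target_exponent; congr expR.
rewrite -mulrA -invfM -natrM; congr (_ / _%:R).
have [k ->] : exists k, s = k.+2 by exists (s - 2)%N; lia.
rewrite subn1 [k.+2.-1]/= [xi k.+2]/= -/(xi k.+1) factS.
set v := (lg n - t)%N; set x := xi k.+1; set f := (k.+1)`!.
rewrite -[4%N]/(2 * 2)%N !expnMn !expnD !expnS !expn0; ring.
Qed.

Lemma target_le_size_bound : expR target_exponent <= size_bound R n (s - 1) (s + t).
Proof.
rewrite ler_expR; apply: ler_wpM2l => //.
rewrite lef_pV2 ?posrE ?ltr0n ?muln_gt0 ?expn_gt0 ?fact_gt0 /= ?ler_nat; try lia.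
rewrite leq_mul2l; apply/orP; right.
have [->|x0] := posnP (xi (s - 1)); first by rewrite !expn0.
by rewrite leq_exp2r // leq_sub2l // leq_addl.
Qed.

End SizeBounds.

Theorem theorem4p7 (R : realType) (m n s t : nat)
    (hn : exists k : nat, n = 2 ^ k) (hmn : n < m)
    (hs : 1 < s) (hst : s + t < lg n) :
  PHP R m n (s - 1) (s + t) -> PHP R m n s t.
Proof.
move=> hyp rho rho_t [prf [href hsize]].
pose u := lg n - t; pose N := size prf.
have su : s < u by rewrite /u; lia.
have axA D : D \in axiom_lines (restrict_cnf rho (BinPHP m n)) -> u <= #|D| <= 2 * u.
  exact: card_axiom_line.
have N1 : 1 < N.
  by apply: short_refutation href => D /axA /andP[h _]; apply: leq_trans h; lia.
have N_lt := hsize; rewrite (size_bound_target R hs hst) in N_lt.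
have [r r_ge r_le] := bottleneck_threshold hs su (target_exponent_ge0 R n s t).
have wprf : {in prf, forall D, is_sdnf s D}.
  by move=> D /(nthP set0)[i hi <-]; case: (href.1 i hi).
have [tau [tau_t ext cov]] := killing_restriction rho_t (ltnW hs) hst wprf
  (bottleneck_survival hs su N_lt r_ge).
case: (hyp tau tau_t).
pose d := r.-1 * s * u; pose K := N * (2 * (2 * u) + 1).
have cardprf := refutation_terms href.1 (fun D hD => proj2 (andP (axA D hD))).
have [|D hD|D hD||q [eq sq hq]] := @simulated_refutation _ s (s - 1) d K tau
    (axiom_lines (restrict_cnf rho (BinPHP m n)))
    (axiom_lines (restrict_cnf tau (BinPHP m n))) prf href.1.
- by apply: axiom_lines_sdnf; lia.
- split; last exact: axiom_simulated hD.
  by have /andP[_] := axA D hD; rewrite /K; nia.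
- by split; [exact: cardprf | rewrite subn1; exact: cov].
- exact: href.2.
exists q; split=> //.
apply: Order.POrderTheory.lt_le_trans (target_le_size_bound R hs hst).
apply: Order.POrderTheory.le_lt_trans (refutation_size_bound hs su N_lt N1 r_le).
by rewrite Num.Theory.ler_nat.
Qed.
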